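(* 1) There is a unique semigroup morphism $\tilde B_3\to\underline{GT}_{ell}$ such that $\Psi_+\mapsto(1,1,g_+=X,g_-=YX)$, $\Psi_-\mapsto(1,1,g_+=XY^{-1},g_-=Y)$, $\varepsilon\mapsto(-1,1,g_+=Y,g_-=X)$. It fits in a commutative square with the morphism $\tilde B_3\to\mathbb Z/2=\{\pm1\}$ ($\Psi_\pm\mapsto1$, $\varepsilon\mapsto-1$), the projection $\underline{GT}_{ell}\to\underline{GT}$, $(\lambda,f,g_+,g_-)\mapsto(\lambda,f)$, and the morphism $\mathbb Z/2\to\underline{GT}$, $-1\mapsto(-1,1)$. 2) The two horizontal maps $\tilde B_3\to\underline{GT}_{ell}$ and $\mathbb Z/2\to\underline{GT}$ of this square are isomorphisms.
   Context: Commutators are $(g,h)=ghg^{-1}h^{-1}$. $F_2$ is the free group on $X,Y$; for $f\in F_2$ and $a,b$ in a group, $f(a,b)$ is the image of $f$ under $X\mapsto a,Y\mapsto b$. $B_n$ is the Artin braid group with generators $\sigma_1,\dots,\sigma_{n-1}$. The reduced elliptic braid group $B_{1,n}$ ($n\ge 1$) has generators $\sigma_1,\dots,\sigma_{n-1},X_1^+,X_1^-$ and relations: the Artin relations for the $\sigma_i$; $(\sigma_1^{\pm1}X_1^\pm)^2=(X_1^\pm\sigma_1^{\pm1})^2$; $(X_1^\pm,\sigma_i)=1$ for $2\le i\le n-1$; $(X_1^-,(X_2^+)^{-1})=\sigma_1^2$; $X_1^\pm X_2^\pm\cdots X_n^\pm=1$, where $X_{i+1}^\pm:=\sigma_i^{\pm1}X_i^\pm\sigma_i^{\pm1}$.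 $\underline{GT}$ is the set of pairs $(\lambda,f)\in(1+2\mathbb Z)\times F_2$ such that, with $m=(\lambda-1)/2$: $f(Y,X)=f(X,Y)^{-1}$; $f(X_3,X_1)X_3^mf(X_2,X_3)X_2^mf(X_1,X_2)X_1^m=1$ in $F_2$, where $X_1=X$, $X_2=Y$, $X_1X_2X_3=1$; and, in $B_4$, $f(\sigma_1^2,\sigma_2\sigma_3^2\sigma_2)f(\sigma_2\sigma_1^2\sigma_2,\sigma_3^2)=f(\sigma_2^2,\sigma_3^2)f(\sigma_1\sigma_2^2\sigma_1,\sigma_3\sigma_2^2\sigma_3)f(\sigma_1^2,\sigma_2^2)$. Its product is $(\lambda,f)(\lambda',f')=(\lambda\lambda',f'')$ with $f''(X,Y)=f\big(f'(X,Y)X^{\lambda'}f'(X,Y)^{-1},Y^{\lambda'}\big)f'(X,Y)$. $\underline{GT}_{ell}$ is the set of $(\lambda,f,g_+,g_-)$ with $(\lambda,f)\in\underline{GT}$, $g_\pm\in F_2$, such that in $B_{1,3}$ (with $m=(\lambda-1)/2$, $g_\pm:=g_\pm(X_1^+,X_1^-)$): $$\big(\sigma_2^{\pm1}\sigma_1^{\pm1}(\sigma_1\sigma_2^2\sigma_1)^{\pm m}g_\pm f(\sigma_1^2,\sigma_2^2)\big)^3=1,\qquad u^2=(g_-,u^{-1}g_+^{-1}u^{-1}),\quad u:=f(\sigma_1^2,\sigma_2^2)\sigma_1^\lambda f(\sigma_1^2,\sigma_2^2)^{-1}.$$ Its product is $(\lambda,f,g_\pm)(\lambda',f',g'_\pm)=(\lambda'',f'',g''_\pm)$,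 with $(\lambda'',f'')$ the product in $\underline{GT}$ and $g''_\pm(X,Y)=g_\pm(g'_+(X,Y),g'_-(X,Y))$. $\tilde B_3$ is the group generated by $\Psi_+,\Psi_-,\varepsilon$ with relations $\Psi_+\Psi_-\Psi_+=\Psi_-\Psi_+\Psi_-$, $\varepsilon\Psi_+\varepsilon\Psi_-=1$, $\varepsilon^2=1$. *)

(* Defs.v *)
From HB Require Import structures.
From mathcomp Require Import all_boot all_order all_algebra.
From mathcomp Require Import generic_quotient boolp classical_sets.

Set Implicit Arguments.
Unset Strict Implicit.
Unset Printing Implicit Defensive.

Local Open Scope quotient_scope.
Local Open Scope group_scope.

(* This is [g h g^-1 h^-1], whereas mathcomp's [~ g, h] is [g^-1 h^-1 g h]. *)
Definition comm (G : baseGroupType) (g h : G) : G := g * h * g^-1 * h^-1.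

Definition zexpg (G : baseGroupType) (x : G) (k : int) : G :=
  match k with Posz n => x ^+ n | Negz n => x ^- n.+1 end.

Notation "x ^z k" := (zexpg x k) (at level 30, k at next level).

(* The letter [(s, true)] stands for [s^-1].                                  *)
Definition word (S : Type) : Type := seq (S * bool).

Section Word.
Variable S : Type.

Definition word_inv (w : word S) : word S :=
  rev [seq (a.1, ~~ a.2) | a <- w].

Lemma word_invK : involutive word_inv.
Proof.
move=> w; rewrite /word_inv map_rev revK -map_comp.
by elim: w => //= -[s b] w ->; rewrite negbK.
Qed.

Lemma word_invM : {morph word_inv : u v / u ++ v >-> v ++ u}.
Proof. by move=> u v; rewrite /word_inv map_cat rev_cat. Qed.

HB.instance Definition _ := gen_eqMixin (word S).
HB.instance Definition _ := gen_choiceMixin (word S).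
HB.instance Definition _ :=
  isMonoid.Build (word S) (@catA _) (@cat0s _) (@cats0 _).
HB.instance Definition _ := hasInv.Build (word S) word_inv.
HB.instance Definition _ :=
  Monoid_isStarMonoid.Build (word S) word_invK word_invM.

Definition letter (s : S) : word S := [:: (s, false)].
End Word.

Section Presented.
Variables (S : Type) (R : word S -> word S -> Prop).

Inductive pres_cong : word S -> word S -> Prop :=
| pres_refl u : pres_cong u u
| pres_sym u v : pres_cong u v -> pres_cong v u
| pres_trans u v w : pres_cong u v -> pres_cong v w -> pres_cong u w
| pres_mul u u' v v' :
    pres_cong u u' -> pres_cong v v' -> pres_cong (u * v) (u' * v')
| pres_cancel u : pres_cong (u * u^-1) 1
| pres_rel u v : R u v -> pres_cong u v.

Definition pres_congb (u v : word S) : bool := `[< pres_cong u v >].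

Lemma pres_congb_refl : reflexive pres_congb.
Proof. by move=> u; apply/asboolP; exact: pres_refl. Qed.

Lemma pres_congb_sym : symmetric pres_congb.
Proof. by move=> u v; apply/asboolP/asboolP; exact: pres_sym. Qed.

Lemma pres_congb_trans : transitive pres_congb.
Proof.
by move=> v u w /asboolP uv /asboolP vw; apply/asboolP; exact: pres_trans vw.
Qed.

Canonical pres_equiv :=
  EquivRel pres_congb pres_congb_refl pres_congb_sym pres_congb_trans.

Definition presented := {eq_quot pres_equiv}.

HB.instance Definition _ := Choice.on presented.
HB.instance Definition _ := EqQuotient.on presented.

Lemma presP (u v : word S) :
  \pi_presented u = \pi_presented v <-> pres_cong u v.
Proof. by split=> [/eqmodP/asboolP //|uv]; apply/eqmodP/asboolP. Qed.

Definition pres_op_mul (x y : presented) : presented :=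
  locked (\pi_presented (repr x * repr y)).
Definition pres_op_inv (x : presented) : presented :=
  locked (\pi_presented (repr x)^-1).

Lemma pres_repr u : pres_cong (repr (\pi_presented u)) u.
Proof. by apply/presP; rewrite reprK. Qed.

Lemma pres_cong_inv u v : pres_cong u v -> pres_cong u^-1 v^-1.
Proof.
move=> uv; apply: (@pres_trans _ (u^-1 * (v * v^-1))).
  rewrite -{1}[u^-1]mulg1; apply: pres_mul; first exact: pres_refl.
  by apply: pres_sym; exact: pres_cancel.
rewrite mulgA -{2}[v^-1]mul1g; apply: pres_mul; last exact: pres_refl.
apply: (@pres_trans _ (u^-1 * u)).
  by apply: pres_mul; [exact: pres_refl|exact: pres_sym].
by have := pres_cancel u^-1; rewrite invgK.
Qed.

Lemma pi_mul u v :
  \pi_presented (u * v) = pres_op_mul (\pi_presented u) (\pi_presented v).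
Proof.
by rewrite /pres_op_mul -lock; apply/presP/pres_sym/pres_mul; exact: pres_repr.
Qed.

Lemma pi_inv u : \pi_presented u^-1 = pres_op_inv (\pi_presented u).
Proof.
rewrite /pres_op_inv -lock.
by apply/presP/pres_cong_inv/pres_sym; exact: pres_repr.
Qed.

Lemma pres_surj (x : presented) : exists u, x = \pi_presented u.
Proof. by exists (repr x); rewrite reprK. Qed.

Lemma pres_mulA : associative pres_op_mul.
Proof.
move=> x y z; case: (pres_surj x) (pres_surj y) (pres_surj z).
by move=> u -> [v ->] [w ->]; rewrite -!pi_mul mulgA.
Qed.

Lemma pres_mul1 : left_id (\pi_presented 1) pres_op_mul.
Proof. by move=> x; case: (pres_surj x) => u ->; rewrite -pi_mul mul1g. Qed.

Lemma pres_mulr1 : right_id (\pi_presented 1) pres_op_mul.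
Proof. by move=> x; case: (pres_surj x) => u ->; rewrite -pi_mul mulg1. Qed.

Lemma pres_mulV : left_inverse (\pi_presented 1) pres_op_inv pres_op_mul.
Proof.
move=> x; case: (pres_surj x) => u ->; rewrite -pi_inv -pi_mul; apply/presP.
by have := pres_cancel u^-1; rewrite invgK.
Qed.

Lemma pres_mulgV : right_inverse (\pi_presented 1) pres_op_inv pres_op_mul.
Proof.
move=> x; case: (pres_surj x) => u ->; rewrite -pi_inv -pi_mul.
by apply/presP; exact: pres_cancel.
Qed.

HB.instance Definition _ := isGroup.Build presented
  pres_mulA pres_mul1 pres_mulr1 pres_mulV pres_mulgV.

Definition pres_class (u : word S) : presented := \pi_presented u.
Definition pres_gen (s : S) : presented := pres_class (letter s).

Lemma pres_classM u v : pres_class (u * v) = pres_class u * pres_class v.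
Proof. exact: pi_mul. Qed.

Lemma pres_classV u : pres_class u^-1 = (pres_class u)^-1.
Proof. exact: pi_inv. Qed.

Lemma pres_classR u v : R u v -> pres_class u = pres_class v.
Proof. by move=> Ruv; apply/presP/pres_rel. Qed.

End Presented.

Variant F2_gen := F2_genX | F2_genY.

Definition F2 : groupType := presented (fun _ _ : word F2_gen => False).

Definition FX : F2 := pres_gen _ F2_genX.
Definition FY : F2 := pres_gen _ F2_genY.

Section Eval.
Variables (G : groupType) (a b : G).

Definition eval_letter (l : F2_gen * bool) : G :=
  let g := match l.1 with F2_genX => a | F2_genY => b end in
  if l.2 then g^-1 else g.

Definition eval_word (w : word F2_gen) : G := \prod_(l <- w) eval_letter l.

Definition eval (f : F2) : G := eval_word (repr f).

Lemma eval_wordM u v : eval_word (u * v) = eval_word u * eval_word v.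
Proof. exact: big_cat. Qed.

Lemma eval_wordV u : eval_word u^-1 = (eval_word u)^-1.
Proof.
elim: u => [|[s c] u IH]; first by rewrite [1^-1]/= /eval_word !big_nil invg1.
have -> : ((s, c) :: u : word F2_gen) = ([:: (s, c)] : word F2_gen) * u by [].
rewrite invgM !eval_wordM IH invgM; congr (_ * _).
by rewrite /eval_word !big_cons !big_nil !mulg1 /eval_letter; case: c => /=;
  rewrite ?invgK.
Qed.

Lemma eval_word_cong R (u v : word F2_gen) :
    (forall r t, R r t -> eval_word r = eval_word t) ->
  pres_cong R u v -> eval_word u = eval_word v.
Proof.
move=> HR; elim=> {u v} [//|//|u v w _ -> _ //|u u' v v' _ Eu _ Ev|u|//].
  by rewrite !eval_wordM Eu Ev.
by rewrite eval_wordM eval_wordV mulgV /eval_word big_nil.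
Qed.

Lemma eval_class (w : word F2_gen) : eval (pres_class _ w) = eval_word w.
Proof. by apply: eval_word_cong (pres_repr _ w). Qed.

Lemma evalM : {morph eval : f g / f * g}.
Proof.
move=> f g; rewrite -[f]reprK -[g]reprK.
by rewrite -[_ * _]pres_classM !eval_class eval_wordM.
Qed.

Lemma evalX : eval FX = a.
Proof. by rewrite eval_class /eval_word big_seq1. Qed.

Lemma evalY : eval FY = b.
Proof. by rewrite eval_class /eval_word big_seq1. Qed.

End Eval.

(* In the braid groups the indices are 1-based: [sigma_i] is the              *)
(* generator of ordinal [i.-1], for [1 <= i < n]; other indices give 1.       *)

Section Braid.
Variable n : nat.

Definition bw (i : nat) : word 'I_n.-1 :=
  if i is j.+1 then if insub j is Some k then letter k else 1 else 1.

Variant braid_rel : word 'I_n.-1 -> word 'I_n.-1 -> Prop :=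
| braid_far i j of 1 <= i & i.+1 < j & j < n :
    braid_rel (bw i * bw j) (bw j * bw i)
| braid_adj i of 1 <= i & i.+1 < n :
    braid_rel (bw i * bw i.+1 * bw i) (bw i.+1 * bw i * bw i.+1).

Definition braid : groupType := presented braid_rel.

Definition sigma (i : nat) : braid := pres_class _ (bw i).
End Braid.

(* The boolean [s] encodes the sign in [X_1^s], [true] being [+].             *)
Definition sgn (s : bool) : int := if s then 1%R else (-1)%R.

Section EllBraid.
Variable n : nat.

Variant ell_gen := EllSigma of 'I_n.-1 | EllX of bool.

Definition ew (i : nat) : word ell_gen :=
  if i is j.+1 then if insub j is Some k then letter (EllSigma k) else 1 else 1.

(* [ex s i] is [X_i^s], for [1 <= i <= n]. *)
Fixpoint ex (s : bool) (i : nat) : word ell_gen :=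
  match i with
  | j.+1 => if j == 0 then letter (EllX s)
            else ew j ^z sgn s * ex s j * ew j ^z sgn s
  | 0 => 1
  end.

Variant ell_rel : word ell_gen -> word ell_gen -> Prop :=
| ell_far i j of 1 <= i & i.+1 < j & j < n :
    ell_rel (ew i * ew j) (ew j * ew i)
| ell_adj i of 1 <= i & i.+1 < n :
    ell_rel (ew i * ew i.+1 * ew i) (ew i.+1 * ew i * ew i.+1)
| ell_sq s of 1 < n :
    ell_rel ((ew 1 ^z sgn s * ex s 1) ^+ 2) ((ex s 1 * ew 1 ^z sgn s) ^+ 2)
| ell_Xsigma s i of 2 <= i & i < n :
    ell_rel (comm (ex s 1) (ew i)) 1
| ell_XX of 1 < n :
    ell_rel (comm (ex false 1) (ex true 2)^-1) (ew 1 ^+ 2)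
| ell_prod s :
    ell_rel (\prod_(1 <= i < n.+1) ex s i) 1.

Definition ellbraid : groupType := presented ell_rel.

Definition esigma (i : nat) : ellbraid := pres_class _ (ew i).
Definition eX (s : bool) : ellbraid := pres_class _ (ex s 1).
End EllBraid.

(* The ambient sets of pairs and quadruples carry the product formulas; the   *)
(* sets GT and GTell are subsets of these.                                    *)

Record GTpair := MkGTpair { GTlam : int; GTf : F2 }.

Definition GTpair_mul (x y : GTpair) : GTpair :=
  MkGTpair (GTlam x * GTlam y)%R
    (eval (GTf y * FX ^z GTlam y * (GTf y)^-1) (FY ^z GTlam y) (GTf x) * GTf y).

HB.instance Definition _ := hasMul.Build GTpair GTpair_mul.

(* Exact for odd [lam]. *)
Definition halfm (lam : int) : int := ((lam - 1)%R %/ 2)%Z.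

Definition GT : set GTpair := [set x |
  let f (G : groupType) (a b : G) := eval a b (GTf x) in
  let m := halfm (GTlam x) in
  let X1 := FX in let X2 := FY in let X3 := (FX * FY)^-1 in
  let s1 := sigma 4 1 in let s2 := sigma 4 2 in let s3 := sigma 4 3 in
  [/\ exists k : int, GTlam x = (1 + 2 * k)%R,
      f _ FY FX = (f _ FX FY)^-1,
      f _ X3 X1 * X3 ^z m * f _ X2 X3 * X2 ^z m * f _ X1 X2 * X1 ^z m = 1 &
      f _ (s1 ^+ 2) (s2 * s3 ^+ 2 * s2) *
        f _ (s2 * s1 ^+ 2 * s2) (s3 ^+ 2) =
      f _ (s2 ^+ 2) (s3 ^+ 2) *
        f _ (s1 * s2 ^+ 2 * s1) (s3 * s2 ^+ 2 * s3) *
        f _ (s1 ^+ 2) (s2 ^+ 2)]].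

Record GTquad := MkGTquad { GTpart : GTpair; GTgp : F2; GTgm : F2 }.

Definition GTquad_mul (x y : GTquad) : GTquad :=
  MkGTquad (GTpart x * GTpart y)
    (eval (GTgp y) (GTgm y) (GTgp x)) (eval (GTgp y) (GTgm y) (GTgm x)).

HB.instance Definition _ := hasMul.Build GTquad GTquad_mul.

Definition GTell : set GTquad := [set x |
  let lam := GTlam (GTpart x) in
  let m := halfm lam in
  let s1 := esigma 3 1 in let s2 := esigma 3 2 in
  let g (s : bool) :=
    eval (eX 3 true) (eX 3 false) (if s then GTgp x else GTgm x) in
  let f := eval (s1 ^+ 2) (s2 ^+ 2) (GTf (GTpart x)) in
  let u := f * s1 ^z lam * f^-1 in
  [/\ GT (GTpart x),
      forall s : bool,
        (s2 ^z sgn s * s1 ^z sgn s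
         * (s1 * s2 ^+ 2 * s1) ^z (sgn s * m)%R * g s * f) ^+ 3 = 1 &
      u ^+ 2 = comm (g false) (u^-1 * (g true)^-1 * u^-1)]].

Lemma GTell_GT (x : GTell) : GTpart (val x) \in GT.
Proof. by case: x => x /= /set_mem[+ _ _]; exact: mem_set. Qed.

Definition GTproj (x : GTell) : GT := exist _ (GTpart (val x)) (GTell_GT x).

(* Multiplicativity of a map into a subset, computed in the ambient magma.    *)
Definition is_semigroup_morphism (G M : magmaType) (A : set M) (phi : G -> A) :=
  forall x y : G, val (phi (x * y)) = val (phi x) * val (phi y).

Variant B3t_gen := B3t_genP | B3t_genM | B3t_genE.

Variant B3t_rel : word B3t_gen -> word B3t_gen -> Prop :=
| B3t_braid : let p := letter B3t_genP in let q := letter B3t_genM in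
    B3t_rel (p * q * p) (q * p * q)
| B3t_eps : let p := letter B3t_genP in let q := letter B3t_genM in
    let e := letter B3t_genE in
    B3t_rel (e * p * e * q) 1
| B3t_eps2 : B3t_rel (letter B3t_genE ^+ 2) 1.

Definition B3t : groupType := presented B3t_rel.

Definition PsiP : B3t := pres_gen _ B3t_genP.
Definition PsiM : B3t := pres_gen _ B3t_genM.
Definition eps : B3t := pres_gen _ B3t_genE.

(* The group {1, -1} of units of the integers.                                *)
Definition is_sign (k : int) : bool := (k == 1)%R || (k == -1)%R.

Definition signs := {k : int | is_sign k}.

HB.instance Definition _ := Choice.on signs.

Lemma signs_mulP (x y : signs) : is_sign (val x * val y)%R.
Proof.
by case: x y => [x /= /orP[]/eqP->] [y /= /orP[]/eqP->].
Qed.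

Definition sign1 : signs := exist is_sign 1%R isT.
Definition signN1 : signs := exist is_sign (-1)%R isT.
Definition sign_mul (x y : signs) : signs := exist is_sign _ (signs_mulP x y).

Lemma sign_mulA : associative sign_mul.
Proof. by move=> x y z; apply: val_inj; rewrite /= GRing.mulrA. Qed.

Lemma sign_mul1 : left_id sign1 sign_mul.
Proof. by move=> x; apply: val_inj; rewrite /= GRing.mul1r. Qed.

Lemma sign_mulr1 : right_id sign1 sign_mul.
Proof. by move=> x; apply: val_inj; rewrite /= GRing.mulr1. Qed.

Lemma sign_mulV : left_inverse sign1 id sign_mul.
Proof. by case=> x hx; apply: val_inj => /=; case/orP: hx => /eqP->. Qed.

HB.instance Definition _ := isGroup.Build signs
  sign_mulA sign_mul1 sign_mulr1 sign_mulV sign_mulV.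

(* Main.v *)
Require Import Defs.
From HB Require Import structures.
From mathcomp Require Import all_boot all_order all_algebra.
From mathcomp Require Import generic_quotient boolp classical_sets.
From mathcomp Require Import zify ring.

Set Implicit Arguments.
Unset Strict Implicit.
Unset Printing Implicit Defensive.

Local Open Scope group_scope.

(** Everything is detected by 2x2 integer matrices.

    GT.  Send X, Y to -s^2, -t^2, where s, t are the images of the braid
    generators in SL_2(Z).  An element r of order 3 modulo the sign permutes X1,
    X2, X3 cyclically, so the hexagon says that (r^-1 f X^m)^3 = -1; with the
    antisymmetry of f its trace is lambda times the upper left entry of f, up to
    sign, whence lambda = +-1 and f = Y^-k X^k.  Counting the crossings of strands
    1 and 2 in the pentagon gives k = 0.

    GT_ell, surjectivity.  Forgetting one of the three strands turns the defining
    equations, for lambda = 1, into (g_-, g_+) = (Y, X) in F_2.  In the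
    representation of F_2 with tr (Y, X) = -2, the traces of g_+, g_-, g_+ g_-
    solve x^2 + y^2 + z^2 = x y z.  Markov descent along the moves of Psi_+-
    brings them to +-3, where the pairs of matrices form a single orbit of
    Psi_- Psi_+.

    GT_ell, injectivity.  Alternating words in a = Psi_+ Psi_- Psi_+ and
    d = Psi_+ Psi_- act faithfully, up to the centre, on Hom(F_2, Z), and
    (a^2)^2 acts on F_2 as conjugation by (Y, X), which has infinite order. *)

(** * Morphisms and presented groups *)

Section Morph.
Variables (G H : groupType) (h : G -> H).
Hypothesis hM : {morph h : x y / x * y}.

Lemma morph1 : h 1 = 1.
Proof. by apply: (mulgI (h 1)); rewrite -hM !mulg1. Qed.

Lemma morphV : {morph h : x / x^-1}.
Proof. by move=> x; apply: (mulgI (h x)); rewrite -hM !mulgV morph1. Qed.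

Lemma morphX n : {morph h : x / x ^+ n}.
Proof. by move=> x; elim: n => [|n IH]; rewrite ?morph1 // !expgS hM IH. Qed.

Lemma morphZ k : {morph h : x / x ^z k}.
Proof. by move=> x; case: k => n; rewrite /zexpg ?morphV morphX. Qed.

Lemma morph_comm : {morph h : x y / comm x y}.
Proof. by move=> x y; rewrite /comm !hM !morphV. Qed.
End Morph.

Section Lift.
Variables (S : Type) (R : word S -> word S -> Prop).

Lemma presented_ind (P : presented R -> Prop) :
  P 1 -> (forall s x, P x -> P (pres_gen R s * x)) ->
  (forall s x, P x -> P ((pres_gen R s)^-1 * x)) -> forall x, P x.
Proof.
move=> P1 PM PV x; case: (pres_surj x) => w ->.
elim: w => [//|[s c] w IH].
have -> : ((s, c) :: w : word S) = ([:: (s, c)] : word S) * w by [].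
rewrite -/(pres_class R _) pres_classM; case: c; last exact: PM.
have -> : ([:: (s, true)] : word S) = (letter s)^-1 by [].
by rewrite pres_classV; exact: PV.
Qed.

Variables (G : groupType) (g : S -> G).

Definition lift_word (w : word S) : G :=
  \prod_(l <- w) (if l.2 then (g l.1)^-1 else g l.1).

Lemma lift_word1 : lift_word 1 = 1.
Proof. by rewrite /lift_word big_nil. Qed.

Lemma lift_wordM u v : lift_word (u * v) = lift_word u * lift_word v.
Proof. exact: big_cat. Qed.

Lemma lift_word_letter s : lift_word (letter s) = g s.
Proof. by rewrite /lift_word big_seq1. Qed.

Lemma lift_wordV u : lift_word u^-1 = (lift_word u)^-1.
Proof.
elim: u => [|[s c] u IH]; first by rewrite lift_word1 invg1 -lift_word1.
have -> : ((s, c) :: u : word S) = ([:: (s, c)] : word S) * u by [].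
rewrite invgM !lift_wordM IH invgM; congr (_ * _).
by rewrite /lift_word !big_seq1; case: c => /=; rewrite ?invgK.
Qed.

Lemma lift_wordX u n : lift_word (u ^+ n) = lift_word u ^+ n.
Proof. by elim: n => [|n IH]; rewrite ?lift_word1 // !expgS lift_wordM IH. Qed.

Lemma lift_wordZ u k : lift_word (u ^z k) = lift_word u ^z k.
Proof. by case: k => n; rewrite /zexpg ?lift_wordV lift_wordX. Qed.

Lemma lift_word_comm u v :
  lift_word (comm u v) = comm (lift_word u) (lift_word v).
Proof. by rewrite /comm !lift_wordM !lift_wordV. Qed.

Lemma lift_word_cong u v :
    (forall r t, R r t -> lift_word r = lift_word t) ->
  pres_cong R u v -> lift_word u = lift_word v.
Proof.
move=> HR; elim=> {u v} [//|//|u v w _ -> _ //|u u' v v' _ Eu _ Ev|u|//].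
  by rewrite !lift_wordM Eu Ev.
by rewrite lift_wordM lift_wordV mulgV lift_word1.
Qed.

(** The universal property of a presentation: [lift_word] is constant on congruence classes, so it
    may be computed on chosen representatives. *)
Lemma presented_lift : (forall r t, R r t -> lift_word r = lift_word t) ->
  exists2 h : presented R -> G, {morph h : x y / x * y} &
    forall w, h (pres_class R w) = lift_word w.
Proof.
move=> HR; pose h (x : presented R) := lift_word (repr x).
have hE w : h (pres_class R w) = lift_word w.
  exact: lift_word_cong (pres_repr R w).
exists h => // x y; case: (pres_surj x) (pres_surj y) => u -> [v ->].
by rewrite -!/(pres_class R _) -pres_classM !hE lift_wordM.
Qed.
End Lift.

Lemma pres_classX S (R : word S -> word S -> Prop) u n :
  pres_class R (u ^+ n) = pres_class R u ^+ n.
Proof. by elim: n => [//|n IH]; rewrite !expgS pres_classM IH. Qed.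

Lemma pres_classZ S (R : word S -> word S -> Prop) u k :
  pres_class R (u ^z k) = pres_class R u ^z k.
Proof. by case: k => n; rewrite /zexpg ?pres_classV pres_classX. Qed.

Lemma pres_class_comm S (R : word S -> word S -> Prop) u v :
  pres_class R (comm u v) = comm (pres_class R u) (pres_class R v).
Proof. by rewrite /comm !pres_classM !pres_classV. Qed.

Section F2.
Lemma F2_ind (P : F2 -> Prop) :
  P 1 -> (forall f, P f -> P (FX * f)) -> (forall f, P f -> P (FY * f)) ->
  (forall f, P f -> P (FX^-1 * f)) -> (forall f, P f -> P (FY^-1 * f)) ->
  forall f, P f.
Proof.
by move=> P1 PX PY PX' PY'; apply: presented_ind => // -[]; auto.
Qed.

Lemma F2_morph_eq (G : groupType) (h k : F2 -> G) :
  {morph h : x y / x * y} -> {morph k : x y / x * y} ->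
  h FX = k FX -> h FY = k FY -> h =1 k.
Proof.
move=> hM kM eX eY; elim/F2_ind => [|f IH|f IH|f IH|f IH];
  by rewrite ?(morph1 hM) ?(morph1 kM) // hM kM ?(morphV hM) ?(morphV kM)
             ?eX ?eY IH.
Qed.

Lemma eval_morph (G : groupType) (h : F2 -> G) :
  {morph h : x y / x * y} -> h =1 eval (h FX) (h FY).
Proof.
move=> hM; apply: F2_morph_eq; rewrite ?evalX ?evalY //; exact: evalM.
Qed.

Lemma morph_eval (G H : groupType) (h : G -> H) a b f :
  {morph h : x y / x * y} -> h (eval a b f) = eval (h a) (h b) f.
Proof.
move=> hM; move: f; apply: F2_morph_eq; rewrite ?evalX ?evalY //.
  by move=> x y; rewrite evalM hM.
exact: evalM.
Qed.

Lemma eval_id : eval FX FY =1 id.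
Proof. by move=> f; rewrite -(@eval_morph F2 id). Qed.

Lemma eval1 (G : groupType) (a b : G) : eval a b 1 = 1.
Proof. exact: morph1 (evalM a b). Qed.

Lemma evalV (G : groupType) (a b : G) : {morph eval a b : f / f^-1}.
Proof. exact: morphV (evalM a b). Qed.
End F2.

(* Products of bijections are read from left to right. *)
Section Bij.
Variable T : Type.

Record bij := Bij {
  bfun :> T -> T; binv : T -> T; bfunK : cancel bfun binv;
  binvK : cancel binv bfun }.

Lemma bijP (f g : bij) : bfun f =1 bfun g -> f = g.
Proof.
case: f g => f f' fK fK' [g g' gK gK'] /= /funext efg.
have efg' : f' = g' by apply/funext => x; rewrite -[in LHS](gK' x) -efg fK.
by subst g g'; congr Bij; exact: Prop_irrelevance.
Qed.

HB.instance Definition _ := gen_eqMixin bij.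
HB.instance Definition _ := gen_choiceMixin bij.

Definition bij1 : bij := @Bij id id (fun=> erefl) (fun=> erefl).
Definition bijM (f g : bij) : bij :=
  Bij (can_comp (bfunK g) (bfunK f)) (can_comp (binvK f) (binvK g)).
Definition bijV (f : bij) : bij := Bij (binvK f) (bfunK f).

Lemma bijMA : associative bijM. Proof. by move=> f g h; exact: bijP. Qed.
Lemma bijM1 : left_id bij1 bijM. Proof. by move=> f; exact: bijP. Qed.
Lemma bij1M : right_id bij1 bijM. Proof. by move=> f; exact: bijP. Qed.
Lemma bijVM : left_inverse bij1 bijV bijM.
Proof. by move=> f; apply: bijP => x /=; rewrite binvK. Qed.
Lemma bijMV : right_inverse bij1 bijV bijM.
Proof. by move=> f; apply: bijP => x /=; rewrite bfunK. Qed.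

HB.instance Definition _ := isGroup.Build bij bijMA bijM1 bij1M bijVM bijMV.

Lemma bijME (f g : bij) x : (f * g) x = g (f x). Proof. by []. Qed.
Lemma bijVE (f : bij) x : f^-1 x = binv f x. Proof. by []. Qed.
Lemma bij1E x : (1 : bij) x = x. Proof. by []. Qed.
End Bij.

(** * Integer matrices and ping-pong *)

Section SL2.
Local Open Scope ring_scope.

(** Four explicit entries turn matrix identities into polynomial identities for [ring], and
    equalities of numerical matrices into computations. *)
Record SL2 := MkSL2 {
  sa : int; sb : int; sc : int; sd : int; sdet : sa * sd - sb * sc = 1 }.

Lemma SL2P (m n : SL2) : sa m = sa n -> sb m = sb n -> sc m = sc n ->
  sd m = sd n -> m = n.
Proof.
case: m n => a b c d h [a' b' c' d' h'] /= ea eb ec ed.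
by subst a' b' c' d'; congr MkSL2; exact: Prop_irrelevance.
Qed.

HB.instance Definition _ := gen_eqMixin SL2.
HB.instance Definition _ := gen_choiceMixin SL2.

Lemma SL2_1 : 1 * 1 - 0 * 0 = 1 :> int. Proof. by []. Qed.
Lemma SL2_mul (m n : SL2) :
  (sa m * sa n + sb m * sc n) * (sc m * sb n + sd m * sd n)
  - (sa m * sb n + sb m * sd n) * (sc m * sa n + sd m * sc n) = 1.
Proof.
by rewrite -[RHS]GRing.mulr1 -{1}(sdet m) -(sdet n); ring.
Qed.
Lemma SL2_inv (m : SL2) : sd m * sa m - (- sb m) * (- sc m) = 1.
Proof. by rewrite -(sdet m); ring. Qed.

Definition SL2one := MkSL2 SL2_1.
Definition SL2mul m n := MkSL2 (SL2_mul m n).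
Definition SL2inv m := MkSL2 (SL2_inv m).

Lemma SL2mulA : associative SL2mul.
Proof. by move=> m n p; apply: SL2P => /=; ring. Qed.
Lemma SL2mul1 : left_id SL2one SL2mul.
Proof. by move=> m; apply: SL2P => /=; ring. Qed.
Lemma SL2mulr1 : right_id SL2one SL2mul.
Proof. by move=> m; apply: SL2P => /=; ring. Qed.
Lemma SL2mulV : left_inverse SL2one SL2inv SL2mul.
Proof.
by move=> m; apply: SL2P => /=; try ring; rewrite -(sdet m); ring.
Qed.
Lemma SL2mulrV : right_inverse SL2one SL2inv SL2mul.
Proof.
by move=> m; apply: SL2P => /=; try ring; rewrite -(sdet m); ring.
Qed.

HB.instance Definition _ := isGroup.Build SL2
  SL2mulA SL2mul1 SL2mulr1 SL2mulV SL2mulrV.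

Lemma SL2_N1 : (-1) * (-1) - 0 * 0 = 1 :> int. Proof. by []. Qed.
Definition SL2N1 := MkSL2 SL2_N1.

Definition SL2act (m : SL2) (v : int * int) : int * int :=
  (sa m * v.1 + sb m * v.2, sc m * v.1 + sd m * v.2).

Lemma SL2actM m n v : SL2act (m * n)%g v = SL2act m (SL2act n v).
Proof. by case: v => x y; rewrite /SL2act /=; congr pair; ring. Qed.

Lemma SL2act1 v : SL2act 1%g v = v.
Proof. by case: v => x y; rewrite /SL2act /=; congr pair; ring. Qed.
End SL2.

Section PingPong.

Definition flip (l : F2_gen * bool) := (l.1, ~~ l.2).

Fixpoint reduced (w : word F2_gen) : Prop :=
  if w is l :: w' then
    (if w' is l' :: _ then l' <> flip l else True) /\ reduced w'
  else True.

Lemma letter_eqdec (l l' : F2_gen * bool) : {l = l'} + {l <> l'}.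
Proof. by case: l l' => [[] []] [[] []]; (left; done) || (right; done). Qed.

(** Prepending a letter to a reduced word either leaves it reduced or cancels its first letter. *)
Lemma reduced_repr (f : F2) :
  exists2 w, reduced w & f = pres_class _ w.
Proof.
have step l g : (exists2 w, reduced w & g = pres_class _ w) ->
    exists2 w, reduced w & pres_class _ [:: l] * g = pres_class _ w :> F2.
  case=> w rw ->; case: w rw => [|l' w] rw.
    by exists [:: l] => //; rewrite -pres_classM.
  case: (letter_eqdec l' (flip l)) => [e|ne]; last first.
    by exists [:: l, l' & w] => //; rewrite -pres_classM.
  exists w; first by case: rw.
  have -> : (l' :: w : word F2_gen) = ([:: l] : word F2_gen)^-1 * w.
    by rewrite e; case: (l) => s c.
  by rewrite pres_classM pres_classV mulVKg.
elim/F2_ind: f => [|f|f|f|f]; first by exists 1.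
- exact: (step (F2_genX, false)).
- exact: (step (F2_genY, false)).
- by move/(step (F2_genX, true)); rewrite -[FX^-1]pres_classV.
- by move/(step (F2_genY, true)); rewrite -[FY^-1]pres_classV.
Qed.

(* For the slope [x / y], [r.1] is its sign and [r.2] tells if it exceeds 1 in *)
(* absolute value.                                                           *)
Definition region (r : bool * bool) (v : int * int) : Prop :=
  let: (x, y) := v in
  (if r.2 then
    if r.1 then (0 < y /\ y < x) \/ (y < 0 /\ x < y)
    else (0 < y /\ x < - y) \/ (y < 0 /\ - y < x)
  else
    if r.1 then (0 < x /\ x < y) \/ (x < 0 /\ y < x)
    else (0 < x /\ y < - x) \/ (x < 0 /\ - x < y))%R.

Lemma region_inj r r' v : region r v -> region r' v -> r = r'.
Proof.
by case: v => x y; case: r r' => [[] []] [[] []] //=; lia.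
Qed.

Variables (a b : SL2) (side : F2_gen * bool -> bool * bool).
Hypothesis side_inj : injective side.
Hypothesis pong : forall l l' v, l' <> flip l -> region (side l') v ->
  region (side l) (SL2act (eval_letter a b l) v).

Lemma ping_pong_word l w c v : reduced (l :: w) ->
    c <> flip (last l w) -> region (side c) v ->
  region (side l) (SL2act (eval_word a b (l :: w)) v).
Proof.
have evc l0 w0 : eval_word a b (l0 :: w0) = eval_letter a b l0 * eval_word a b w0.
  by rewrite /eval_word big_cons.
elim: w l => [|l' w IH] l; rewrite evc SL2actM.
  by move=> _ nc rc; rewrite /eval_word big_nil SL2act1; apply: pong rc.
by case=> ne rw nc rc; apply: pong ne _; exact: IH.
Qed.

(** A nonempty reduced word moves the region of every letter not inverse to its last letter into the
    region of its first letter [l]. Among four letters one can be chosen that also differs from [l],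
    and its region is not preserved. *)
Lemma ping_pong f :
    (forall r v, region r v -> region r (SL2act (eval a b f) v)) -> f = 1.
Proof.
case: (reduced_repr f) => -[|l w] rw -> // ; rewrite eval_class => fix_reg.
have [c nc nl] : exists2 c, c <> flip (last l w) & c <> l.
  case: (last l w) => s1 e1; case: (l) => s2 e2; case: s1 e1 s2 e2 => [] [] [] [];
    by [exists (F2_genX, true)|exists (F2_genX, false)
       |exists (F2_genY, true)|exists (F2_genY, false)].
have [v rv] : exists v, region (side c) v.
  by case: (side c) => [[] []];
    [exists (2, 1)%R|exists (1, 2)%R|exists (2, -1)%R|exists (1, -2)%R] => /=; lia.
case: nl; apply: side_inj.
exact: region_inj (fix_reg _ _ rv) (ping_pong_word rw nc rv).
Qed.

(** The regions are stable under negation, so ping-pong gives injectivity even modulo sign. *)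
Lemma eval_SL2_inj f g :
  eval a b f = eval a b g \/ eval a b f = SL2N1 * eval a b g -> f = g.
Proof.
move=> efg; suff: f * g^-1 = 1 by move/divg1_eq.
apply: ping_pong => r v; rewrite evalM evalV.
by case: efg => ->; rewrite ?mulgK ?mulgV ?SL2act1 //;
  case: v => x y; case: r => [[] []] /=; lia.
Qed.

End PingPong.

(** * Two representations of [F2], faithful modulo sign *)

Local Open Scope ring_scope.
Lemma det_s : 1 * 1 - 1 * 0 = 1 :> int. Proof. by []. Qed.
Lemma det_t : 1 * 1 - 0 * -1 = 1 :> int. Proof. by []. Qed.
Lemma det_A : 2 * 1 - (-1) * (-1) = 1 :> int. Proof. by []. Qed.
Lemma det_B : 2 * 1 - 1 * 1 = 1 :> int. Proof. by []. Qed.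
Local Close Scope ring_scope.

(** [mS] and [mT] satisfy the braid relation. [mA], [mB] and [mA * mB] have trace 3, the fundamental
    solution of [x^2 + y^2 + z^2 = x y z]. *)
Definition mS := MkSL2 det_s.
Definition mT := MkSL2 det_t.
Definition mA := MkSL2 det_A.
Definition mB := MkSL2 det_B.

(* With these signs [(X Y)^-1] is the conjugate of [Y] by [mR] below. *)
Definition sanovX := SL2N1 * (mS * mS).
Definition sanovY := SL2N1 * (mT * mT).
Definition sanov := eval sanovX sanovY.

(** [sanovX] adds 2 to the slope [x / y] and [sanovY] subtracts 2 from [y / x]; the table lists the
    attracting region of each letter. *)
Lemma sanov_inj f g : sanov f = sanov g \/ sanov f = SL2N1 * sanov g -> f = g.
Proof.
apply: (@eval_SL2_inj _ _ (fun l => match l with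
  (F2_genX, false) => (true, true) | (F2_genX, true) => (false, true)
  | (F2_genY, false) => (false, false) | (F2_genY, true) => (true, false) end)).
  by case=> [[] []] [[] []].
by case=> [[] []] [[] []] [x y] //= _; lia.
Qed.

Definition markov := eval mA mB.

(** The regions are the arcs between the slopes 0, 1, infinity and -1. [mA] and [mB] pair opposite
    sides of this ideal quadrilateral, a fundamental domain of the once-punctured torus. *)
Lemma markov_inj f g :
  markov f = markov g \/ markov f = SL2N1 * markov g -> f = g.
Proof.
apply: (@eval_SL2_inj _ _ (fun l => match l with
  (F2_genX, false) => (false, true) | (F2_genX, true) => (true, false)
  | (F2_genY, false) => (true, true) | (F2_genY, true) => (false, false) end)).
  by case=> [[] []] [[] []].
by case=> [[] []] [[] []] [x y] //= _; lia.
Qed.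

(** * The semigroup GT *)

Section SanovGT.
Local Open Scope ring_scope.

Lemma det_w : 0 * 0 - 1 * -1 = 1 :> int. Proof. by []. Qed.
Definition mW := MkSL2 det_w.

(** Its trace is 1, hence its cube is -1. *)
Definition mR := (mS * mT)%g.

(** The sign [e] is [(-1)^k], recorded through its square. *)
Lemma sanovX_zexp k : exists2 e : int, e * e = 1 &
  [/\ sa (sanovX ^z k) = e, sb (sanovX ^z k) = e * (2 * k),
      sc (sanovX ^z k) = 0 & sd (sanovX ^z k) = e].
Proof.
have pos n : exists2 e : int, e * e = 1 &
  [/\ sa (sanovX ^+ n)%g = e, sb (sanovX ^+ n)%g = e * (2 * n%:Z),
      sc (sanovX ^+ n)%g = 0 & sd (sanovX ^+ n)%g = e].
  elim: n => [|n [e e2 [ea eb ec ed]]]; first by exists 1.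
  exists (- e); first lia.
  by rewrite expgS /= ea eb ec ed; split; lia.
case: k => n; first exact: pos.
have [e e2 [ea eb ec ed]] := pos n.+1.
exists e => //. have -> : sanovX ^z Negz n = SL2inv (sanovX ^+ n.+1)%g by [].
by split; rewrite /= ?ea ?eb ?ec ?ed; lia.
Qed.

Lemma sanovY_zexp k : exists2 e : int, e * e = 1 &
  [/\ sa (sanovY ^z k) = e, sb (sanovY ^z k) = 0,
      sc (sanovY ^z k) = - e * (2 * k) & sd (sanovY ^z k) = e].
Proof.
have pos n : exists2 e : int, e * e = 1 &
  [/\ sa (sanovY ^+ n)%g = e, sb (sanovY ^+ n)%g = 0,
      sc (sanovY ^+ n)%g = - e * (2 * n%:Z) & sd (sanovY ^+ n)%g = e].
  elim: n => [|n [e e2 [ea eb ec ed]]]; first by exists 1.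
  exists (- e); first lia.
  by rewrite expgS /= ea eb ec ed; split; lia.
case: k => n; first exact: pos.
have [e e2 [ea eb ec ed]] := pos n.+1.
exists e => //. have -> : sanovY ^z Negz n = SL2inv (sanovY ^+ n.+1)%g by [].
by split; rewrite /= ?ea ?eb ?ec ?ed; lia.
Qed.

(** The image lies in the congruence subgroup of level 2. Oddness keeps the diagonal entries away
    from 0; evenness provides the exponent in [sanov_shape]. *)
Lemma sanov_even f : exists k l p q : int,
  [/\ sa (sanov f) = 1 + 2 * p, sb (sanov f) = 2 * k, sc (sanov f) = 2 * l &
      sd (sanov f) = 1 + 2 * q].
Proof.
elim/F2_ind: f => [|f|f|f|f]; first by exists 0, 0, 0, 0; rewrite /sanov eval1.
all: case=> [k [l [p [q [ea eb ec ed]]]]].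
all: rewrite /sanov evalM ?evalV ?evalX ?evalY -/(sanov f) /= ea eb ec ed.
- by exists (-k-1-2 * q), (-l), (-1-p-2 * l), (-1-q); split; lia.
- by exists (-k), (1 + 2 * p-l), (-1-p), (2 * k-1-q); split; lia.
- by exists (-k+1+2 * q), (-l), (-1-p+2 * l), (-1-q); split; lia.
- by exists (-k), (-1 - 2 * p-l), (-1-p), (-2 * k-1-q); split; lia.
Qed.

(** By Cayley-Hamilton, [m^3 = (t^2 - 1) m - t] with [t] the trace; compare the lower left
    entries. *)
Lemma trace_cube (m : SL2) :
  (m * m * m)%g = SL2N1 -> sc m <> 0 -> (sa m + sd m) ^+ 2 = 1.
Proof.
move=> e nz; have [_ _ + _] : [/\ sa (m * m * m)%g = -1, sb (m * m * m)%g = 0,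
  sc (m * m * m)%g = 0 & sd (m * m * m)%g = -1] by rewrite e.
have -> : sc (m * m * m)%g = ((sa m + sd m) ^+ 2 - 1) * sc m.
  by rewrite /= -(sdet m); ring.
by move/eqP; rewrite GRing.mulf_eq0 => /orP[/eqP|/eqP //]; lia.
Qed.
End SanovGT.

Lemma conj_morph (G : groupType) (r : G) :
  {morph (fun g => r * g * r^-1) : x y / x * y}.
Proof. by move=> x y; rewrite !mulgA mulgVK. Qed.

(* Conjugation by [r] is the cyclic permutation of the [X_i] in the hexagon. *)
Lemma hexagon_cube (G : groupType) (r F P : G) :
    r * (r * F / r) / r * (r * (r * P / r) / r) * (r * F / r) * (r * P / r)
      * F * P = 1 ->
  r^-1 * F * P * (r^-1 * F * P) * (r^-1 * F * P) = r^-1 * r^-1 * r^-1.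
Proof.
move=> e; rewrite -[RHS]mulg1 -e.
by rewrite !mulgA !(mulgVK, mulgK).
Qed.

(** Put [N = R^-1 F X^k]. The hexagon gives [N^3 = -1]. Once [F] is symmetric, with upper left entry
    [a], the trace of [N] is [e lam a] and its lower left entry is [e a], nonzero as [a] is odd. So
    [(lam a)^2 = 1], and both factors are signs. *)
Lemma hexagon_sanov (lam k : int) (f : F2) :
    lam = (1 + 2 * k)%R ->
    eval FY FX f = (eval FX FY f)^-1 ->
    eval (FX * FY)^-1 FX f * (FX * FY)^-1 ^z k * eval FY (FX * FY)^-1 f
      * FY ^z k * eval FX FY f * FX ^z k = 1 ->
  [/\ lam = 1 \/ lam = -1,
      sa (sanov f) = 1 \/ sa (sanov f) = -1 & sb (sanov f) = sc (sanov f)]%R.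
Proof.
move=> lamE anti hex; have sM := evalM sanovX sanovY.
(* Conjugation by [mW] exchanges the images of [X] and [Y], so the antisymmetry of [f] says that it
   inverts the matrix of [f]; the upper right entries give the symmetry. *)
have bc : sb (sanov f) = sc (sanov f).
  have: mW * sanov f * mW^-1 = (sanov f)^-1.
    rewrite (@morph_eval _ _ (fun g => mW * g * mW^-1)); last exact: conj_morph.
    have -> : mW * sanovX * mW^-1 = sanovY by exact: SL2P.
    have -> : mW * sanovY * mW^-1 = sanovX by exact: SL2P.
    rewrite -(morphV sM) -[f in RHS]eval_id -anti (morph_eval _ _ _ sM).
    by rewrite evalX evalY.
  by move/(congr1 sb) => /=; lia.
set F := sanov f in bc *; set X3 := (sanovX * sanovY)^-1.
have conjX r : {morph (fun g => r * g * r^-1) : x y / x * y :> SL2} := conj_morph r.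
have rX : mR * sanovX * mR^-1 = sanovY by exact: SL2P.
have rY : mR * sanovY * mR^-1 = X3 by exact: SL2P.
have rX3 : mR * X3 * mR^-1 = sanovX by exact: SL2P.
have rF : mR * F * mR^-1 = eval sanovY X3 f.
  by rewrite (morph_eval _ _ _ (conjX mR)) rX rY.
have rrF : mR * eval sanovY X3 f * mR^-1 = eval X3 sanovX f.
  by rewrite (morph_eval _ _ _ (conjX mR)) rY rX3.
have rk : mR * sanovX ^z k * mR^-1 = sanovY ^z k.
  by rewrite (morphZ (conjX mR)) rX.
have rrk : mR * sanovY ^z k * mR^-1 = X3 ^z k.
  by rewrite (morphZ (conjX mR)) rY.
have cube : let N := mR^-1 * F * sanovX ^z k in N * N * N = SL2N1.
  move: hex => /(congr1 sanov); rewrite /sanov !sM !(morph_eval _ _ _ sM).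
  rewrite !(morphZ sM) !(morphV sM) !sM evalX evalY -/X3 (morph1 sM).
  rewrite -/sanov -/(sanov f) -/F -rrk -rrF -rk -rF.
  move/hexagon_cube => /= ->; exact: SL2P.
have [e e2 [ea eb ec ed]] := sanovX_zexp k.
have nz : sa F <> 0%R.
  move=> a0; have [p [q [r [t [+ _ _ _]]]]] := sanov_even f.
  by rewrite -/F a0; lia.
have entries : (sa (mR^-1 * F * sanovX ^z k)%g + sd (mR^-1 * F * sanovX ^z k)%g
    = e * (lam * sa F) :> int)%R.
  by rewrite lamE /= ea eb ec ed bc; lia.
have tr := trace_cube cube; rewrite entries in tr.
have {}tr : ((lam * sa F) * (lam * sa F) = 1)%R.
  by rewrite -[RHS]tr; [rewrite -[LHS]GRing.mul1r -e2; ring|rewrite /= ea ec; lia].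
have /eqP := congr1 absz tr; rewrite !abszM !muln_eq1 => /andP[/andP[]].
by split=> //; lia.
Qed.

(** Up to sign, a symmetric matrix of determinant 1 with upper left entry 1 is determined by its
    off-diagonal entry. [Y^-p X^p] gives such a matrix with off-diagonal entry [2 p]. *)
Lemma sanov_shape f : (sa (sanov f) = 1 \/ sa (sanov f) = -1)%R ->
  sb (sanov f) = sc (sanov f) -> exists k, f = FY ^z (- k)%R * FX ^z k.
Proof.
have sM : {morph sanov : x y / x * y} := evalM _ _.
have [sX sY] : sanov FX = sanovX /\ sanov FY = sanovY.
  by rewrite /sanov evalX evalY.
move=> a1 bc; have [k [_ [_ [_ [_ eb _ _]]]]] := sanov_even f.
(* The factor [sa (sanov f)] normalises the upper left entry to 1. *)
have [p pE] : exists p, p = (sa (sanov f) * k)%R by exists (sa (sanov f) * k)%R.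
have det := sdet (sanov f); exists p; apply: sanov_inj.
rewrite sM !(morphZ sM) sX sY.
have [e e2 [ea' eb' ec' ed']] := sanovX_zexp p.
have [g g2 [ga gb gc gd]] := sanovY_zexp (- p)%R.
have dE : sd (sanov f) = (sa (sanov f) * (1 + 2 * k * (2 * k)))%R by nia.
have {}e2 : (e = 1 \/ e = -1)%R by nia.
have {}g2 : (g = 1 \/ g = -1)%R by nia.
case: a1 => a1; rewrite a1 in pE dE; case: e2 => e1; case: g2 => g1.
all: (left; apply: SL2P;
       rewrite /= ?ea' ?eb' ?ec' ?ed' ?ga ?gb ?gc ?gd -?bc ?dE ?eb ?a1 ?pE ?e1 ?g1;
       lia) ||
     (right; apply: SL2P;
       rewrite /= ?ea' ?eb' ?ec' ?ed' ?ga ?gb ?gc ?gd -?bc ?dE ?eb ?a1 ?pE ?e1 ?g1;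
       lia).
Qed.

(** * Crossing numbers in [B_4] and the pentagon *)

Lemma bwE n i (lt_i : i < n.-1) : bw n i.+1 = letter (Ordinal lt_i).
Proof. by rewrite /bw insubT. Qed.

Section Braid4.
Variables (G : groupType) (s1 s2 s3 : G).
Hypotheses (far : s1 * s3 = s3 * s1) (adj12 : s1 * s2 * s1 = s2 * s1 * s2)
  (adj23 : s2 * s3 * s2 = s3 * s2 * s3).

Lemma braid4_lift : exists2 h : braid 4 -> G, {morph h : x y / x * y} &
  [/\ h (sigma 4 1) = s1, h (sigma 4 2) = s2 & h (sigma 4 3) = s3].
Proof.
pose g (i : 'I_3) := nth 1 [:: s1; s2; s3] i.
(* Braid indices start at 1 and ordinals at 0, hence the leading 1; indices out of range give the
   trivial word. *)
have gE i : lift_word g (bw 4 i) = nth 1 [:: 1; s1; s2; s3] i.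
  case: i => [|i]; first exact: lift_word1.
  have [lt_i|ge_i] := ltnP i 3; first by rewrite bwE lift_word_letter.
  by rewrite /bw insubF ?lift_word1 1?ltnNge ?ge_i //; case: i ge_i => [|[|[|[]]]].
have [u v|h hM hE] := @presented_lift _ (@braid_rel 4) _ g.
  case=> [i j|i] le1 lt; rewrite !lift_wordM !gE.
    by case: i le1 lt => [|[|[|i]]] // _; case: j => [|[|[|[|j]]]].
  by case: i le1 lt => [|[|[|i]]].
by exists h => //; rewrite !hE !gE.
Qed.
End Braid4.

Variant pair4 := P12 | P13 | P14 | P23 | P24 | P34.

(* [pair4 * int] carries the action of [B_4] on pairs of strands, the integer *)
(* counting the crossings of the pair.                                         *)
Section Crossings.
Local Open Scope ring_scope.

Definition swap_pair (i : nat) (p : pair4) : pair4 :=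
  match i, p with
  | 1, P13 => P23 | 1, P23 => P13 | 1, P14 => P24 | 1, P24 => P14
  | 2, P12 => P13 | 2, P13 => P12 | 2, P24 => P34 | 2, P34 => P24
  | 3, P13 => P14 | 3, P14 => P13 | 3, P23 => P24 | 3, P24 => P23
  | _, _ => p
  end.

Lemma swap_pairK i : involutive (swap_pair i).
Proof. by case: i => [|[|[|[|i]]]] []. Qed.

Definition crossing (i : nat) (p : pair4) : int :=
  match i, p with 1, P12 | 2, P23 | 3, P34 => 1 | _, _ => 0 end.

Lemma crossing_swap i p : crossing i (swap_pair i p) = crossing i p.
Proof. by case: i => [|[|[|[|i]]]]; case: p. Qed.

Definition cross i (x : pair4 * int) := (swap_pair i x.1, x.2 + crossing i x.1).
Definition uncross i (x : pair4 * int) := (swap_pair i x.1, x.2 - crossing i x.1).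

Lemma crossK i : cancel (cross i) (uncross i).
Proof.
by case=> p z; rewrite /cross /uncross /= swap_pairK crossing_swap; congr pair; ring.
Qed.
Lemma uncrossK i : cancel (uncross i) (cross i).
Proof.
by case=> p z; rewrite /cross /uncross /= swap_pairK crossing_swap; congr pair; ring.
Qed.

Definition bcross i : bij (pair4 * int) := Bij (crossK i) (uncrossK i).

(** On the stabiliser of the pair [P12] the crossing count is a homomorphism to the integers, so its
    value on [f(a, b)] follows from those on [a] and [b]. *)
Definition winds (g : bij (pair4 * int)) (n : int) :=
  forall z, g (P12, z) = (P12, z + n).

Lemma windsM g g' n n' : winds g n -> winds g' n' -> winds (g * g')%g (n + n').
Proof. by move=> gn gn' z; rewrite bijME gn gn' GRing.addrA. Qed.

Lemma winds1 : winds 1%g 0. Proof. by move=> z; rewrite GRing.addr0. Qed.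

Lemma windsV g n : winds g n -> winds g^-1%g (- n).
Proof. by move=> gn z; rewrite -[z in LHS](GRing.addrNK n) -gn bijVE bfunK. Qed.

Lemma windsX g n k : winds g n -> winds (g ^+ k)%g (k%:Z * n).
Proof.
move=> gn; elim: k => [|k IH]; first by rewrite GRing.mul0r; exact: winds1.
by rewrite expgS (_ : k.+1%:Z * n = n + k%:Z * n); [exact: windsM|lia].
Qed.

Lemma windsZ g n k : winds g n -> winds (g ^z k) (k * n).
Proof.
move=> gn; case: k => k; first exact: windsX.
by rewrite NegzE GRing.mulNr; apply/windsV/windsX.
Qed.
End Crossings.

(** Strands 1 and 2 cross twice in [s1^2] and in [s1 s2^2 s1], and never in the other arguments. The
    left side thus counts [2 k] crossings and the right side [4 k]. *)
Lemma pentagon_trivial (k : int) (f : F2) : f = FY ^z (- k)%R * FX ^z k ->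
    let s1 := sigma 4 1 in let s2 := sigma 4 2 in let s3 := sigma 4 3 in
    eval (s1 ^+ 2) (s2 * s3 ^+ 2 * s2) f * eval (s2 * s1 ^+ 2 * s2) (s3 ^+ 2) f
    = eval (s2 ^+ 2) (s3 ^+ 2) f * eval (s1 * s2 ^+ 2 * s1) (s3 * s2 ^+ 2 * s3) f
      * eval (s1 ^+ 2) (s2 ^+ 2) f ->
  k = 0%R.
Proof.
move=> fE s1 s2 s3.
have [|||h hM [h1 h2 h3]] := @braid4_lift _ (bcross 1) (bcross 2) (bcross 3).
- by apply: bijP => -[[] z] //; rewrite /= /cross /=; congr pair; ring.
- by apply: bijP => -[[] z] //; rewrite /= /cross /=; congr pair; ring.
- by apply: bijP => -[[] z] //; rewrite /= /cross /=; congr pair; ring.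
move/(congr1 h); rewrite !hM !(morph_eval _ _ _ hM) !hM h1 h2 h3.
have fw g g' n n' : winds g n -> winds g' n' ->
    winds (eval g g' f) (- k * n' + k * n)%R.
  move=> gn gn'; rewrite fE evalM !(morphZ (evalM g g')) evalX evalY.
  by apply: windsM; exact: windsZ.
have w1 i : winds (bcross i * bcross i)
    (crossing i P12 + crossing i (swap_pair i P12))%R.
  by move=> z; rewrite /= /cross /= swap_pairK GRing.addrA.
have w2 i j : winds (bcross i * (bcross j * bcross j) * bcross i) (
  crossing i P12 + crossing j (swap_pair i P12) + crossing j (swap_pair i P12)
  + crossing i P12)%R.
  move=> z; rewrite /= /cross /= !crossing_swap !swap_pairK !crossing_swap.
  by rewrite !GRing.addrA.
move=> /(congr1 (fun g : bij _ => (g (P12, 0%R)).2)).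
rewrite !bijME !(fw _ _ _ _ (w1 _) (w1 _), fw _ _ _ _ (w2 _ _) (w1 _),
                 fw _ _ _ _ (w1 _) (w2 _ _), fw _ _ _ _ (w2 _ _) (w2 _ _)) /=.
lia.
Qed.

Lemma GT_sign (x : GTpair) : GT x ->
  GTf x = 1 /\ (GTlam x = 1 \/ GTlam x = -1)%R.
Proof.
case: x => lam f [/= [k lamE] anti hex pent].
rewrite /halfm lamE -lamE in hex *.
have mE : ((lam - 1) %/ 2)%Z = k by lia.
rewrite mE in hex.
have [lam1 a1 bc] := hexagon_sanov lamE anti hex.
have [j fE] := sanov_shape a1 bc.
by split=> //; rewrite fE (pentagon_trivial fE pent) mulg1.
Qed.

Lemma halfm1 : halfm 1%R = 0%R. Proof. by []. Qed.
Lemma halfmN1 : halfm (-1)%R = (-1)%R. Proof. by []. Qed.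

Lemma sign_GT (e : int) : (e = 1 \/ e = -1)%R -> GT (MkGTpair e 1).
Proof.
move=> e1; split; rewrite ?eval1 ?mulg1 ?mul1g ?invg1 //=.
  by case: e1 => ->; [exists 0%R|exists (-1)%R].
case: e1 => ->; first by rewrite halfm1 /= !mulg1.
by rewrite halfmN1 /= !expg1 invgK mulgK mulgV.
Qed.

Lemma zexpg1 (G : groupType) (x : G) : x ^z 1%R = x. Proof. by []. Qed.
Lemma zexpgN1 (G : groupType) (x : G) : x ^z (-1)%R = x^-1.
Proof. by rewrite /= expg1. Qed.

(** * The elliptic braid group on three strands *)

Section ThreeStrands.
Variables (G : groupType) (s1 s2 x : G).
Hypotheses (adj : s1 * s2 * s1 = s2 * s1 * s2) (xs2 : x * s2 = s2 * x).

(** With [X_2 = s1 x s1] and [X_3 = s2 X_2 s2] the right side is [X_3 x X_2]: the cube is trivial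
    exactly when the cyclically rotated product relation holds. *)
Lemma cube_prod : s1^-1 * (s2 * s1 * x) ^+ 3 * s1 =
  s2 * (s1 * x * s1) * s2 * x * (s1 * x * s1).
Proof.
rewrite !expgS expg0 mulg1 !mulgA.
rewrite -[s1^-1 * s2 * s1 * x * s2]mulgA xs2 !mulgA.
rewrite -[_ * x * s2 in LHS]mulgA xs2 -(mulgA s1^-1 s2 s1) -(mulgA s1^-1) -adj.
by rewrite !mulgA mulVg mul1g.
Qed.

Lemma cube_eq1 : s2 * (s1 * x * s1) * s2 * (x * (s1 * x * s1)) = 1 ->
  (s2 * s1 * x) ^+ 3 = 1.
Proof.
rewrite mulgA -cube_prod => /(canRL (mulgK _))/(canRL (mulKg _)).
by rewrite mul1g invgK mulgV.
Qed.

Lemma sigma1_x3 : s1 * (s2 * (s1 * x * s1) * s2) = s2 * (s1 * x * s1) * s2 * s1.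
Proof.
rewrite !mulgA adj -(mulgA _ s2 x) -xs2 !mulgA.
by rewrite -(mulgA _ s2 s1) -(mulgA _ (s2 * s1)) -adj !mulgA.
Qed.

Hypothesis cube : (s2 * s1 * x) ^+ 3 = 1.

Lemma x3_inv : (s2 * (s1 * x * s1) * s2)^-1 = x * (s1 * x * s1).
Proof. by apply: mulg1_eq; rewrite mulgA -cube_prod cube mulg1 mulVg. Qed.

Lemma prod_x : x * (s1 * x * s1) * (s2 * (s1 * x * s1) * s2) = 1.
Proof. by rewrite -x3_inv mulVg. Qed.

Lemma x1x2_sigma1 : s1 * (x * (s1 * x * s1)) = x * (s1 * x * s1) * s1.
Proof. by rewrite -x3_inv; apply: commuteV; exact: sigma1_x3. Qed.

(** [s1] commutes with [X_3], hence with its inverse [x s1 x s1]. *)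
Lemma square_x : (s1 * x) ^+ 2 = (x * s1) ^+ 2.
Proof.
by apply: (mulIg s1); have := x1x2_sigma1; rewrite !expg2 !mulgA.
Qed.
End ThreeStrands.

(* Presents [B_{1,3}]: the relations [ell_sq] and [ell_prod] follow from the *)
(* two cubes.                                                                *)
Record ell3 (G : groupType) (s1 s2 xp xm : G) : Prop := Ell3 {
  ell3_adj : s1 * s2 * s1 = s2 * s1 * s2;
  ell3_Xp2 : xp * s2 = s2 * xp;
  ell3_Xm2 : xm * s2 = s2 * xm;
  ell3_cubep : (s2 * s1 * xp) ^+ 3 = 1;
  ell3_cubem : (s2^-1 * s1^-1 * xm) ^+ 3 = 1;
  ell3_XX : s1 ^+ 2 = comm xm (s1^-1 * xp^-1 * s1^-1) }.

Lemma adj_inv (G : groupType) (s1 s2 : G) :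
  s1 * s2 * s1 = s2 * s1 * s2 ->
  s1^-1 * s2^-1 * s1^-1 = s2^-1 * s1^-1 * s2^-1.
Proof. by move/(congr1 (fun g => g^-1)); rewrite !invgM !mulgA. Qed.

Lemma ewE n i (lt_i : i < n.-1) : ew n i.+1 = letter (EllSigma (Ordinal lt_i)).
Proof. by rewrite /ew insubT. Qed.

Section EllLift.
Variables (G : groupType) (s1 s2 xp xm : G).
Hypothesis E : ell3 s1 s2 xp xm.

Lemma ell3_lift : exists2 h : ellbraid 3 -> G, {morph h : x y / x * y} &
  [/\ h (esigma 3 1) = s1, h (esigma 3 2) = s2, h (eX 3 true) = xp &
      h (eX 3 false) = xm].
Proof.
case: E => adj xp2 xm2 cubep cubem XX.
have adjV := adj_inv adj; have xm2V := commuteV xm2.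
pose g (l : ell_gen 3) := match l with
  | EllSigma i => nth 1 [:: s1; s2] i | EllX b => if b then xp else xm end.
have gE i : lift_word g (ew 3 i) = nth 1 [:: 1; s1; s2] i.
  case: i => [|i]; first exact: lift_word1.
  have [lt_i|ge_i] := ltnP i 2; first by rewrite ewE lift_word_letter.
  by rewrite /ew insubF ?lift_word1 1?ltnNge ?ge_i //; case: i ge_i => [|[|[]]].
have gX s : lift_word g (ex 3 s 1) = if s then xp else xm.
  by rewrite lift_word_letter.
have gX2 s : lift_word g (ex 3 s 2) =
    s1 ^z sgn s * (if s then xp else xm) * s1 ^z sgn s.
  rewrite (_ : ex 3 s 2 = ew 3 1 ^z sgn s * ex 3 s 1 * ew 3 1 ^z sgn s) //.
  by rewrite !lift_wordM lift_wordZ gE gX.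
have gX3 s : lift_word g (ex 3 s 3) =
    s2 ^z sgn s * (s1 ^z sgn s * (if s then xp else xm) * s1 ^z sgn s)
    * s2 ^z sgn s.
  rewrite (_ : ex 3 s 3 = ew 3 2 ^z sgn s * ex 3 s 2 * ew 3 2 ^z sgn s) //.
  by rewrite 2!lift_wordM lift_wordZ gE gX2.
have [u v|h hM hE] := @presented_lift _ (@ell_rel 3) _ g.
  case=> [i j|i|s _|s i|_|s].
  - by case: i => [|[|i]] // _; case: j => [|[|[]]].
  - by case: i => [|[|i]] // _ _; rewrite !lift_wordM !gE.
  - rewrite !lift_wordX !lift_wordM lift_wordZ gE gX; case: s.
      exact: (square_x adj xp2 cubep).
    by rewrite zexpgN1; apply: (square_x adjV xm2V cubem).
  - case: i => [|[|[|i]]] // _ _; rewrite lift_word_comm gE gX lift_word1 /comm /=.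
    by case: s; rewrite ?xp2 ?xm2 mulgK mulgV.
  - rewrite lift_word_comm lift_wordV lift_wordX gE gX2 gX XX.
    by rewrite zexpg1 !invgM !mulgA.
  - rewrite lift_word1 3?big_ltn ?big_geq // mulg1 2!lift_wordM gX3 gX2 gX mulgA.
    case: s; first exact: (prod_x adj xp2 cubep).
    by rewrite !zexpgN1; apply: (prod_x adjV xm2V cubem).
exists h => //; rewrite [eX 3 true]/(pres_class _ _) [eX 3 false]/(pres_class _ _).
by rewrite !hE !gE !gX.
Qed.
End EllLift.

Lemma ell3_esigma : ell3 (esigma 3 1) (esigma 3 2) (eX 3 true) (eX 3 false).
Proof.
have adj : esigma 3 1 * esigma 3 2 * esigma 3 1 =
    esigma 3 2 * esigma 3 1 * esigma 3 2.
  by rewrite -!pres_classM; apply: pres_classR; apply: ell_adj.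
have Xs s : eX 3 s * esigma 3 2 = esigma 3 2 * eX 3 s.
  have : comm (eX 3 s) (esigma 3 2) = 1.
    by rewrite -pres_class_comm; apply: pres_classR; apply: ell_Xsigma.
  by move/divg1_eq => /(congr1 (fun g => g * eX 3 s)); rewrite mulgVK.
have prodX s : let x := eX 3 s in let s1 := esigma 3 1 ^z sgn s in
    let s2 := esigma 3 2 ^z sgn s in
    x * (s1 * x * s1) * (s2 * (s1 * x * s1) * s2) = 1.
  move=> /=; rewrite -!pres_classZ -!pres_classM.
  rewrite -[RHS](pres_classR (ell_prod 3 s)); congr pres_class.
  by rewrite 3?big_ltn ?big_geq // mulg1 [RHS]mulgA.
have cube s : (esigma 3 2 ^z sgn s * esigma 3 1 ^z sgn s * eX 3 s) ^+ 3 = 1.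
  have e1 : (esigma 3 1 ^z sgn s) * (esigma 3 2 ^z sgn s) * (esigma 3 1 ^z sgn s)
    = esigma 3 2 ^z sgn s * esigma 3 1 ^z sgn s * esigma 3 2 ^z sgn s.
    by case: (s) => //; rewrite !zexpgN1; exact: adj_inv.
  have e2 : eX 3 s * (esigma 3 2 ^z sgn s) = esigma 3 2 ^z sgn s * eX 3 s.
    by case: (s); rewrite ?zexpgN1; [exact: Xs|exact: commuteV (Xs _)].
  apply: (cube_eq1 e1 e2); have /eqP := prodX s; rewrite mulg_eq1 => /eqP ->.
  exact: mulgV.
split=> //; [exact: (cube true)|exact: (cube false)|].
rewrite -!pres_classX -(pres_classR (ell_XX _)) // pres_class_comm pres_classV.
by rewrite !pres_classM !invgM !mulgA.
Qed.

(** Normalises products as in a free group: left association, inverses pushed to the letters,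
    adjacent inverse letters cancelled. *)
Definition freegE (G : groupType) :=
  (@mulgA G, @invgM G, @invgK G, @invg1 G, @mulgK G, @mulgVK G, @mulgV G,
   @mulVg G, @mul1g G, @mulg1 G).

(** Derives one relation from another through a free-group identity: [a b^-1] is the conjugate of
    [c d^-1] by an explicit [L]. *)
Lemma conj_rel (G : groupType) (L c d a b : G) :
  c = d -> a * b^-1 = L * (c * d^-1) * L^-1 -> a = b.
Proof. by move=> ->; rewrite mulgV mulg1 mulgV => /divg1_eq. Qed.

(** * Invariance of the elliptic relations under the three generators *)

Section Ell3Moves.
Variables (G : groupType) (s1 s2 x y : G).
Hypothesis E : ell3 s1 s2 x y.

Lemma ell3_swap : ell3 s1^-1 s2^-1 y x.
Proof.
case: E => adj x2 y2 cx cy XX; split; rewrite ?invgK //; try exact: commuteV.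
  exact: adj_inv.
apply: (@conj_rel _ (s1^-1 * y^-1 * s1 * x * s1^-1) _ _ _ _ (esym XX)).
by rewrite /comm !expg2 !freegE.
Qed.

Local Notation x2 := (s1 * x * s1).
Local Notation y2 := (s1^-1 * y * s1^-1).
Local Notation x3 := (s2 * x2 * s2).
Local Notation y3 := (s2^-1 * y2 * s2^-1).

(** Start of a computation, ending with [ell3_x3y3], of how the [X_i^+] conjugate the [X_j^-]: each
    time a pure braid factor appears. *)
Lemma ell3_xy2 : x * y2 * x^-1 = y2 * s1 * s1.
Proof.
apply: (@conj_rel _ (s1^-1 * y * s1) _ _ _ _ (ell3_XX ell3_swap)).
by rewrite /comm !expg2 !freegE.
Qed.

Lemma ell3_sxsx : s1 * x * s1 * x = x * s1 * x * s1.
Proof.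
have := square_x (ell3_adj E) (ell3_Xp2 E) (ell3_cubep E).
by rewrite !expg2 !mulgA.
Qed.

Lemma ell3_sy3 : s1 * y3 = y3 * s1.
Proof.
have := sigma1_x3 (adj_inv (ell3_adj E)) (commuteV (ell3_Xm2 E)).
by move/(congr1 (fun g => s1 * g * s1)); rewrite !freegE.
Qed.

Lemma ell3_xy3 : x * y3 * x^-1 = y3 * s2 * s1 * s1 * s2^-1.
Proof.
have xs2 := commuteV (ell3_Xp2 E).
have -> : x * y3 * x^-1 = s2^-1 * (x * y2 * x^-1) * s2^-1.
  have xs2' := commuteV (commute_sym xs2).
  rewrite !mulgA -xs2 -!mulgA; do 5 congr (_ * _).
  by rewrite xs2'.
by rewrite ell3_xy2 !freegE.
Qed.

Lemma ell3_x2y3 : x2 * y3 * x2^-1 = y3 * s2 * s2.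
Proof.
have -> : x2 * y3 * x2^-1 = s1 * (x * y3 * x^-1) * s1^-1.
  by apply: (@conj_rel _ (s1 * x) _ _ _ _ ell3_sy3); rewrite !freegE.
have adj := ell3_adj E.
rewrite ell3_xy3; transitivity (s1 * y3 * (s2 * s1 * s1 * s2^-1 * s1^-1)).
  by rewrite !mulgA.
rewrite ell3_sy3 -[LHS]mulgA -[RHS]mulgA; congr (_ * _).
apply: (mulIg (s1 * s2)); rewrite !freegE adj.
by rewrite -(mulgA (s2 * s1)) -(mulgA s2 s1) (mulgA s1 s2) adj !mulgA.
Qed.

(** Since [x3^-1 = x * x2], it suffices to conjugate [y3] by [x2] and then by [x]. *)
Lemma ell3_x3y3 : x3^-1 * y3 * x3 = y3 * s2 * s1 * s1 * s2.
Proof.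
have x3V := x3_inv (ell3_adj E) (ell3_Xp2 E) (ell3_cubep E).
rewrite -[x3 in X in _ * _ * X]invgK x3V.
have -> : x * x2 * y3 * (x * x2)^-1 = x * (x2 * y3 * x2^-1) * x^-1.
  by rewrite invgM !mulgA.
rewrite ell3_x2y3.
have -> : x * (y3 * s2 * s2) * x^-1 = x * y3 * x^-1 * s2 * s2.
  have xs2 := commuteV (commute_sym (ell3_Xp2 E)).
  by rewrite -!mulgA; do 6 congr (_ * _); rewrite xs2 !mulgA xs2.
by rewrite ell3_xy3 mulgVK.
Qed.

(** After replacing [y] by [y x], the product of the first two new [X_i^-] is [y3^-1 x3^-1] and the
    third is [y3 x3 (s2 s1^2 s2)^-1]. By [ell3_x3y3] the last factor is a commutator of [y3] and
    [x3], and everything cancels. *)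
Lemma ell3_moveP : ell3 s1 s2 x (y * x).
Proof.
case: (E) => adj xs2 ys2 cx cy XX.
have ys2' : y * x * s2 = s2 * (y * x) by apply/commute_sym/commuteM; exact: commute_sym.
split=> //.
- have x3V := x3_inv adj xs2 cx.
  have y3V := x3_inv (adj_inv adj) (commuteV ys2) cy.
  apply: cube_eq1; [exact: adj_inv|exact: commuteV|].
  have -> : y * x * (s1^-1 * (y * x) * s1^-1) = y3^-1 * x3^-1.
    rewrite y3V x3V; transitivity (y * (x * y2 * x^-1) * x * s1 * x * s1^-1).
      by rewrite !freegE.
    rewrite ell3_xy2; transitivity (y * y2 * s1 * (s1 * x * s1 * x) * s1^-1).
      by rewrite !freegE.
    rewrite ell3_sxsx; transitivity (y * y2 * (s1 * x * s1 * x)).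
      by rewrite !freegE.
    by rewrite ell3_sxsx !freegE.
  have -> : s2^-1 * (s1^-1 * (y * x) * s1^-1) * s2^-1 =
      y3 * x3 * (s2 * s1 * s1 * s2)^-1 by rewrite !freegE.
  have -> : s2 * s1 * s1 * s2 = y3^-1 * (x3^-1 * y3 * x3).
    by rewrite ell3_x3y3 -!(mulgA y3) mulKg.
  by move: x3 y3 => p q; rewrite !freegE.
- rewrite XX; apply: (@conj_rel _ (y * x2^-1) _ _ _ _ (esym ell3_sxsx)).
  by rewrite /comm !freegE.
Qed.

(** The inverse move; conjugated by [ell3_swap] it yields [PsiM]. *)
Lemma ell3_moveN : ell3 s1 s2 x (y * x^-1).
Proof.
case: (E) => adj xs2 ys2 cx cy XX.
have ys2' : y * x^-1 * s2 = s2 * (y * x^-1).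
  by apply/commute_sym/commuteM; [exact: commute_sym|exact/commuteV/commute_sym].
split=> //.
- have x3V := x3_inv adj xs2 cx.
  have y3V := x3_inv (adj_inv adj) (commuteV ys2) cy.
  apply: cube_eq1; [exact: adj_inv|exact: commuteV|].
  have -> : y * x^-1 * (s1^-1 * (y * x^-1) * s1^-1) = y3^-1 * x3.
    rewrite -[x3]invgK y3V x3V.
    transitivity (y * x^-1 * (y2 * s1 * s1) * s1^-1 * x^-1 * s1^-1).
      by rewrite !freegE.
    rewrite -ell3_xy2; transitivity (y * y2 * (s1 * x * s1 * x)^-1).
      by rewrite !freegE.
    by rewrite ell3_sxsx !freegE.
  have -> : s2^-1 * (s1^-1 * (y * x^-1) * s1^-1) * s2^-1 =
      y3 * (s2 * s1 * s1 * s2) * x3^-1 by rewrite !freegE.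
  have -> : s2 * s1 * s1 * s2 = y3^-1 * (x3^-1 * y3 * x3).
    by rewrite ell3_x3y3 -!(mulgA y3) mulKg.
  by move: x3 y3 => p q; rewrite !freegE.
- rewrite XX; apply: (@conj_rel _ (y * x2^-1 * x^-1) _ _ _ _ ell3_sxsx).
  by rewrite /comm !freegE.
Qed.

End Ell3Moves.

Lemma ell3_morph (G H : groupType) (h : G -> H) s1 s2 x y :
  {morph h : x y / x * y} -> ell3 s1 s2 x y -> ell3 (h s1) (h s2) (h x) (h y).
Proof.
move=> hM [adj x2 y2 cx cy XX].
have h1 := morph1 hM; have hX := morphX hM; have hV := morphV hM.
split; rewrite -?hV -?hM -?hX; last by rewrite XX (morph_comm hM) !hM !hV.
- by rewrite adj.
- by rewrite x2.
- by rewrite y2.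
- by rewrite cx.
- by rewrite cy.
Qed.

(** * Elements of [GTell] as solutions of the relations of [B_{1,3}] *)

Definition gtq (e : int) (gp gm : F2) : GTquad := MkGTquad (MkGTpair e 1) gp gm.

Lemma GTpairM e e' : MkGTpair e 1 * MkGTpair e' 1 = MkGTpair (e * e')%R 1.
Proof.
have -> : MkGTpair e 1 * MkGTpair e' 1 =
  GTpair_mul (MkGTpair e 1) (MkGTpair e' 1) by [].
by rewrite /GTpair_mul /= eval1 mulg1.
Qed.

Lemma gtqM e p q e' p' q' :
  gtq e p q * gtq e' p' q' = gtq (e * e')%R (eval p' q' p) (eval p' q' q).
Proof.
have -> : gtq e p q * gtq e' p' q' =
  GTquad_mul (gtq e p q) (gtq e' p' q') by [].
by rewrite /GTquad_mul /= GTpairM.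
Qed.

Notation is_unit e := (e = 1 \/ e = -1)%R.
Notation evell := (eval (eX 3 true) (eX 3 false)).

(** For [lambda = -1] the factor in [m] inverts the braid generators:
    [s2 s1 (s1 s2^2 s1)^-1 = s2^-1 s1^-1]. Commutation with [s2] is automatic, as both [X_1^+] and
    [X_1^-] commute with it. *)
Lemma GTell_gtq e gp gm : is_unit e -> GTell (gtq e gp gm) <->
  ell3 (esigma 3 1 ^z e) (esigma 3 2 ^z e) (evell gp) (evell gm).
Proof.
move=> e1; have [adj xp2 xm2 _ _ _] := ell3_esigma.
have comm2 g : evell g * esigma 3 2 = esigma 3 2 * evell g.
{ apply/esym; elim/F2_ind: g => [|f IH|f IH|f IH|f IH].
    by rewrite eval1 mulg1 mul1g.
  all: rewrite evalM ?evalV ?evalX ?evalY; apply: (commuteM _ IH).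
  all: by try apply: commuteV; exact: commute_sym. }
have comm2V g := commuteV (comm2 g).
rewrite /GTell /= !eval1 invg1 !mul1g !mulg1.
split=> [[_ cube XX]|[_ _ _ cp cm XX]]; last split.
- move: (cube true) (cube false) XX => {cube}.
  case: e1 => ->; rewrite ?halfm1 ?halfmN1 /= ?mulg1 ?expg1 => cp cm XX.
    by split=> //; exact: comm2.
  have sp (a b c : ellbraid 3) : a = b -> (b * c) ^+ 3 = 1 -> (a * c) ^+ 3 = 1.
    by move=> ->.
  rewrite invgK in XX; split; rewrite ?invgK //.
  + exact: adj_inv.
  + exact: comm2V.
  + exact: comm2V.
  + by apply: sp cp; rewrite !expg2 !freegE.
  + by apply: sp cm; rewrite !expg2 !freegE.
- by apply: sign_GT.
- move: cp cm; case: e1 => ->; rewrite ?halfm1 ?halfmN1 /= ?expg1 => cp cm [];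
    rewrite /= ?mulg1 ?expg1 //.
  + by rewrite -[RHS]cp; congr (_ ^+ 3); rewrite !expg2 !freegE.
  + by rewrite -[RHS]cm; congr (_ ^+ 3); rewrite !expg2 !freegE.
- by [].
Qed.

Lemma GTell_shape x : GTell x ->
  exists e gp gm, is_unit e /\ x = gtq e gp gm.
Proof.
case: x => -[lam f] gp gm [/GT_sign /= [-> lam1] _ _].
by exists lam, gp, gm.
Qed.

(** The second factor defines an endomorphism of [B_{1,3}]; applied to the relations satisfied by
    the first factor, it gives those of the product. *)
Lemma GTell_mul x y : GTell x -> GTell y -> GTell (x * y).
Proof.
move=> Gx Gy; have [e [p [q [e1 xE]]]] := GTell_shape Gx.
have [e' [p' [q' [e1' yE]]]] := GTell_shape Gy; subst x y; rewrite gtqM.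
move/(GTell_gtq _ _ e1): Gx => Ex; move/(GTell_gtq _ _ e1'): Gy => Ey.
have ee1 : is_unit (e * e')%R by lia.
apply/(GTell_gtq _ _ ee1).
have [h hM [h1 h2 hp hm]] := ell3_lift Ey.
have := ell3_morph hM Ex; rewrite !(morphZ hM) !(morph_eval _ _ _ hM) h1 h2 hp hm.
have ev g : evell (eval p' q' g) = eval (evell p') (evell q') g.
  by rewrite (morph_eval _ _ _ (evalM _ _)).
have zz (g : ellbraid 3) : (g ^z e') ^z e = g ^z (e * e')%R.
  by case: e1 e1' => -> [] ->; rewrite /= ?expg1 ?invgK.
by rewrite !ev !zz.
Qed.

Lemma GTell_eps : GTell (gtq (-1)%R FY FX).
Proof.
apply/GTell_gtq; first by right.
by rewrite evalX evalY !zexpgN1; exact: ell3_swap ell3_esigma.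
Qed.

Lemma GTell_PsiP : GTell (gtq 1%R FX (FY * FX)).
Proof.
apply/GTell_gtq; first by left.
by rewrite evalM evalX evalY; exact: ell3_moveP ell3_esigma.
Qed.

Lemma GTell_PsiM : GTell (gtq 1%R (FX * FY^-1) FY).
Proof.
apply/GTell_gtq; first by left.
rewrite evalM evalV evalX evalY.
by have := ell3_swap (ell3_moveN (ell3_swap ell3_esigma)); rewrite !invgK.
Qed.

(** * Forgetting a strand *)

Section SL2Conj.
Local Open Scope ring_scope.

Lemma SL2N1_central (m : SL2) : (SL2N1 * m = m * SL2N1)%g.
Proof. by apply: SL2P => /=; ring. Qed.

Lemma SL2N1_sq : (SL2N1 * SL2N1 = 1)%g.
Proof. exact: SL2P. Qed.

Lemma SL2_center (g : SL2) : (forall m, m ^ g = m)%g -> g = 1%g \/ g = SL2N1.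
Proof.
move=> cg; have cgE m : (m * g = g * m)%g by rewrite conjgC cg.
have := cgE mS => /[dup] /(congr1 sa) /= c0 /(congr1 sb) /= ad.
have := cgE mT => /(congr1 sa) /= b0.
have det := sdet g.
have {}c0 : sc g = 0 by lia.
have {}b0 : sb g = 0 by lia.
have {}ad : sa g = sd g by lia.
have a1 : sa g = 1 \/ sa g = -1 by nia.
by case: a1 => a1; [left|right]; apply: SL2P => //=; lia.
Qed.
End SL2Conj.

Lemma conjg_eq_sign (g h : SL2) : (forall m, m ^ g = m ^ h) ->
  g = h \/ g = SL2N1 * h.
Proof.
move=> gh; have [m|e|e] := @SL2_center (g * h^-1).
- by rewrite conjgM gh conjgK.
- by left; apply: divg1_eq.
- by right; rewrite -e mulgVK.
Qed.

Lemma conjg_sign (g h m : SL2) : g = h \/ g = SL2N1 * h -> m ^ g = m ^ h.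
Proof.
case=> -> //; rewrite conjgM; congr (_ ^ h).
by rewrite conjgE -SL2N1_central mulKg.
Qed.

(* [B_{1,3}] acts on the strands with labels in [SL2]: on the fibre over a     *)
(* strand it acts by forgetting that strand, the reduced [B_{1,2}] acting on   *)
(* [SL2] by conjugation through [sigma -> T^3], [X -> A], [Y -> B].            *)
Variant strand := St1 | St2 | St3.

Section Wreath.
Variables (p : strand -> strand) (c : strand -> SL2).
Hypothesis pK : involutive p.

Definition wr (x : strand * SL2) := (p x.1, x.2 ^ c x.1).
Definition wr_inv (x : strand * SL2) := (p x.1, x.2 ^ (c (p x.1))^-1).

Lemma wrK : cancel wr wr_inv.
Proof. by case=> k m; rewrite /wr /wr_inv /= pK conjgK. Qed.
Lemma wr_invK : cancel wr_inv wr.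
Proof. by case=> k m; rewrite /wr /wr_inv /= pK conjgKV. Qed.

Definition wreath : bij (strand * SL2) := Bij wrK wr_invK.
End Wreath.

Lemma det_S3 : (1 * 1 - 3 * 0 = 1 :> int)%R. Proof. by []. Qed.
Definition mS3 := MkSL2 det_S3.

Definition swap12 k := match k with St1 => St2 | St2 => St1 | St3 => St3 end.
Definition swap23 k := match k with St1 => St1 | St2 => St3 | St3 => St2 end.
Lemma swap12K : involutive swap12. Proof. by case. Qed.
Lemma swap23K : involutive swap23. Proof. by case. Qed.

(** A crossing acts nontrivially only over the strand it does not involve, since elsewhere one of
    its strands is forgotten. Likewise [X_1] disappears with strand 1. *)
Definition w1 := wreath (fun k => if k is St3 then mS3 else 1) swap12K.
Definition w2 := wreath (fun k => if k is St1 then mS3 else 1) swap23K.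
Definition wX (g : SL2) : bij (strand * SL2) :=
  wreath (p := id) (fun k => if k is St1 then 1 else g) (fun=> erefl).

Lemma wXM g h : wX (g * h) = wX g * wX h.
Proof. by apply: bijP => -[[] m]; rewrite bijME /= /wr /= ?conjgM ?conjg1. Qed.

Lemma wX_eval f : eval (wX mA) (wX mB) f = wX (markov f).
Proof. by rewrite (morph_eval _ _ _ wXM). Qed.

(** [mS3], [mA] and [mB] satisfy the relations of the reduced [B_{1,2}] up to sign, which
    conjugation does not see. *)
Lemma ell3_wreath : ell3 w1 w2 (wX mA) (wX mB).
Proof.
have SASA : mS3 * mA * mS3 * mA = SL2N1 * 1 by exact: SL2P.
have SBSB : mS3^-1 * mB * mS3^-1 * mB = SL2N1 * 1 by exact: SL2P.
have SS : mS3 * mS3 =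
    SL2N1 * (mB * mS3^-1 * mA^-1 * mS3^-1 * mB^-1 * mS3 * mA * mS3).
  exact: SL2P.
split; apply: bijP => -[[] m];
  rewrite /= /wr /wr_inv /= ?(invg1, conjg1) -?conjgM ?mulgA; congr pair.
all: rewrite ?mulgV ?mulVg ?conjg1; try reflexivity.
all: try by rewrite (conjg_sign _ (or_intror SASA)) conjg1.
all: try by rewrite (conjg_sign _ (or_intror SBSB)) conjg1.
exact: conjg_sign (or_intror SS).
Qed.

(** Write [S] for [mS3]. Over strand 2 the cube gives [S U S = U^-1] up to sign; over strand 3 the
    last relation then gives [S^2 = (V, U)] up to sign. As [(mB, mA) = - S^2], injectivity modulo
    sign concludes. *)
Lemma GTell_comm gp gm : GTell (gtq 1%R gp gm) -> comm gm gp = comm FY FX.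
Proof.
move/(GTell_gtq _ _ (or_introl erefl)); rewrite !zexpg1 => E.
have [h hM [h1 h2 hp hm]] := ell3_lift ell3_wreath.
have := ell3_morph hM E; rewrite !(morph_eval _ _ _ hM) h1 h2 hp hm !wX_eval.
set U := markov gp; set V := markov gm; move=> [_ _ _ cube _ XX]; apply: markov_inj.
have mM : {morph markov : x y / x * y} := evalM _ _.
have [mX mY] : markov FX = mA /\ markov FY = mB by rewrite /markov evalX evalY.
rewrite !(morph_comm mM) mX mY -/U -/V.
have SUSU : mS3 * U * mS3 * U = 1 \/ mS3 * U * mS3 * U = SL2N1.
  apply: SL2_center => m.
  have := congr1 (fun g : bij _ => (g (St2, m)).2) cube.
  by rewrite /= /wr /wr_inv /= ?conjg1 -?conjgM ?mulgA.
have SS : mS3 * mS3 = V * (mS3^-1 * U^-1 * mS3^-1) * V^-1 * (mS3 * U * mS3) \/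
  mS3 * mS3 = SL2N1 * (V * (mS3^-1 * U^-1 * mS3^-1) * V^-1 * (mS3 * U * mS3)).
  apply: conjg_eq_sign => m.
  have := congr1 (fun g : bij _ => (g (St3, m)).2) XX.
  by rewrite /= /wr /wr_inv /= ?(invg1, conjg1) -?conjgM ?mulgA.
have -> : comm mB mA = SL2N1 * (mS3 * mS3) by exact: SL2P.
have SUS : V * (mS3^-1 * U^-1 * mS3^-1) * V^-1 * (mS3 * U * mS3) = comm V U.
  have -> : mS3^-1 * U^-1 * mS3^-1 = (mS3 * U * mS3)^-1 by rewrite !invgM !mulgA.
  case: SUSU => /(canRL (mulgK _)) ->; rewrite /comm ?mul1g ?invgK // invgM invgK.
  have -> : SL2N1^-1 = SL2N1 by exact: SL2P.
  rewrite -!mulgA; do 2 congr (_ * _).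
  rewrite (mulgA V^-1) -SL2N1_central -(mulgA SL2N1 V^-1).
  by rewrite (mulgA SL2N1 SL2N1) SL2N1_sq mul1g.
case: SS => ->; rewrite SUS ?mulgA ?SL2N1_sq ?mul1g; first by right.
by left.
Qed.

(** * Markov descent *)

Section Trace.
Local Open Scope ring_scope.
Import Order.TTheory GRing.Theory Num.Theory.

Definition tr (m : SL2) : int := sa m + sd m.

Lemma trMC m n : tr (m * n)%g = tr (n * m)%g.
Proof. by rewrite /tr /=; ring. Qed.

Lemma trV m : tr m^-1%g = tr m.
Proof. by rewrite /tr /=; ring. Qed.

Lemma trF m n : tr (m * n^-1)%g = tr m * tr n - tr (m * n)%g.
Proof. by rewrite /tr /=; ring. Qed.

Lemma trMM m n : tr (m * n * n)%g = tr (m * n)%g * tr n - tr m.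
Proof. by have := trF (m * n)%g n; rewrite mulgK => ->; ring. Qed.

Lemma trJ m n : tr (m * n * m^-1)%g = tr n.
Proof. by rewrite trMC mulKg. Qed.

(** Fricke's trace identity; inserting the determinants makes it a polynomial identity. *)
Lemma tr_comm m n :
  tr (comm m n) = tr m ^+ 2 + tr n ^+ 2 + tr (m * n)%g ^+ 2
                  - tr m * tr n * tr (m * n)%g - 2.
Proof.
have -> : tr m ^+ 2 + tr n ^+ 2 + tr (m * n)%g ^+ 2
    - tr m * tr n * tr (m * n)%g - 2 =
  tr m ^+ 2 * (sa n * sd n - sb n * sc n)
  + tr n ^+ 2 * (sa m * sd m - sb m * sc m) + tr (m * n)%g ^+ 2
  - tr m * tr n * tr (m * n)%g
  - 2 * (sa m * sd m - sb m * sc m) * (sa n * sd n - sb n * sc n).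
  by rewrite !sdet; ring.
by rewrite /tr /comm /=; ring.
Qed.

(** [x y z <= 2 (x^2 + y^2) <= 4 y z] gives [x <= 4], and [2 z^2 <= x y z] gives [2 z <= x y]; a
    finite check remains. *)
Lemma markov_sorted (x y z : nat) : (0 < x)%N -> (x <= y <= z)%N ->
    (x * x + y * y + z * z = x * y * z)%N -> (z * z <= x * x + y * y)%N ->
  [/\ x = 3, y = 3 & z = 3]%N.
Proof.
move=> x0 /andP[xy yz] e le.
have yz0 : (0 < y * z)%N by nia.
have xx : (x * x <= y * y)%N by exact: leq_mul.
have yy : (y * y <= y * z)%N by rewrite leq_mul2l yz orbT.
have x4 : (x <= 4)%N by rewrite -(leq_pmul2r yz0); lia.
have z2 : (2 * z <= x * y)%N.
  by have z0 : (0 < z)%N; [lia|rewrite -(leq_pmul2r z0); lia].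
have x3 : x = 3%N.
  case: x x0 xy e le x4 z2 xx => [|[|[|[|[|x]]]]] //= _ xy e le _ z2 xx; try nia.
rewrite x3 in e le z2 *.
have y4 : (y <= 4)%N by nia.
have z6 : (z <= 6)%N by lia.
move: y z {xx yy yz0 x0 xy yz x4 z2} y4 z6 e le.
do 5 (case=> [|+] //); try lia.
all: do 7 (case=> [|+] //); try lia.
Qed.

Lemma absz_sqrD (p q : int) :
  `|(p ^+ 2 + q ^+ 2)%R|%N = (`|p| * `|p| + `|q| * `|q|)%N.
Proof.
apply/eqP; rewrite -eqz_nat abszE PoszD !PoszM !abszE -!expr2 -!normrX.
by rewrite !ger0_norm ?sqr_ge0 ?addr_ge0 ?sqr_ge0.
Qed.

(** Vieta jumping: as a quadratic equation in [r], the other root is [p q - r] and the product of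
    the roots is [p^2 + q^2]. If no jump decreases, [markov_sorted] applies to the sorted absolute
    values. *)
Lemma markov_descent (x y z : int) : x ^+ 2 + y ^+ 2 + z ^+ 2 = x * y * z ->
    x != 0 -> y != 0 -> z != 0 ->
  [\/ (`|(x * y - z)%R| < `|z|)%N, (`|(x * z - y)%R| < `|y|)%N,
      (`|(y * z - x)%R| < `|x|)%N |
      [/\ `|x| = 3, `|y| = 3 & `|z| = 3]%N].
Proof.
move=> e x0 y0 z0.
have vieta (p q r : int) : p ^+ 2 + q ^+ 2 + r ^+ 2 = p * q * r ->
    (`|(p * q - r)%R| < `|r|)%N \/ (`|r| * `|r| <= `|p| * `|p| + `|q| * `|q|)%N.
  move=> er; have [le|lt] := leqP (`|r| * `|r|) (`|p| * `|p| + `|q| * `|q|)%N.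
    by right.
  left; have : (`|r| * `|(p * q - r)%R| = `|p| * `|p| + `|q| * `|q|)%N.
    rewrite -abszM -absz_sqrD; congr absz.
    by rewrite -[RHS](GRing.addrK (r ^+ 2)) er; ring.
  move=> er'; rewrite -er' ltn_mul2l in lt.
  by case/andP: lt.
have eN : (`|x| * `|x| + `|y| * `|y| + `|z| * `|z| = `|x| * `|y| * `|z|)%N.
  rewrite -!abszM -e; apply/eqP; rewrite -eqz_nat !PoszD !abszE.
  rewrite -!expr2 !ger0_norm ?addr_ge0 ?sqr_ge0 //.
have [lt|hz] := vieta x y z e; first by apply: Or41.
have [|lt|hy] := vieta x z y _;
  [by rewrite -GRing.addrAC e; ring|by apply: Or42|].
have [|lt|hx] := vieta y z x _;
  [by rewrite GRing.addrC GRing.addrA e; ring|by apply: Or43|].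
apply: Or44; move: x0 y0 z0; rewrite -!absz_gt0.
move: `|x|%N `|y|%N `|z|%N eN hx hy hz => {e vieta}{}x {}y {}z e hx hy hz x0 y0 z0.
have srt := markov_sorted.
have [xy|/ltnW xy] := leqP x y; have [yz|/ltnW yz] := leqP y z;
  have [xz|/ltnW xz] := leqP x z.
all: first [ by case: (srt x y z) => //; lia
  | by case: (srt x z y) => //; lia
  | by case: (srt y x z) => //; lia
  | by case: (srt y z x) => //; lia
  | by case: (srt z x y) => //; lia
  | by case: (srt z y x) => //; lia ].
Qed.
End Trace.

(* Pairs reached from [(X, Y)] by the moves of [PsiP], [PsiM] and inverses. *)
Inductive nielsen : F2 -> F2 -> Prop :=
| nielsen_id : nielsen FX FY
| nielsen_P u v of nielsen u v : nielsen u (v * u)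
| nielsen_PV u v of nielsen u v : nielsen u (v * u^-1)
| nielsen_MV u v of nielsen u v : nielsen (u * v) v
| nielsen_M u v of nielsen u v : nielsen (u * v^-1) v.

(** * Matrix pairs at the bottom of the descent *)

Section Terminal.
Local Open Scope ring_scope.

Lemma det_mU p : p * (3 - p) - (1 - p * (3 - p)) * -1 = 1 :> int.
Proof. by ring. Qed.
Lemma det_mV p : (4 - p) * (p - 1) - ((4 - p) * (p - 1) - 1) * 1 = 1 :> int.
Proof. by ring. Qed.

(* The solutions of [comm V U = comm B A] with all three traces equal to 3. *)
Definition mU p := MkSL2 (det_mU p).
Definition mV p := MkSL2 (det_mV p).

(* [PsiM * PsiP] shifts the parameter by [-1]. *)
Lemma mU_step p : mU (p - 1) = (mV p)^-1%g.
Proof. by apply: SL2P => /=; ring. Qed.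
Lemma mV_step p : mV (p - 1) = (mV p * mU p)%g.
Proof. by apply: SL2P => /=; ring. Qed.

(** The parameter 2 is the pair [(mA, mB)], and the moves shift the parameter by 1 in both
    directions. *)
Lemma mUV_nielsen p : exists u v,
  [/\ nielsen u v, markov u = mU p & markov v = mV p].
Proof.
have mM : {morph markov : x y / (x * y)%g} := evalM _ _.
have down (q : int) :
    (exists u v, [/\ nielsen u v, markov u = mU q & markov v = mV q]) ->
    exists u v, [/\ nielsen u v, markov u = mU (q - 1) &
      markov v = mV (q - 1)].
  case=> u [v [n mu mv]]; exists (u * (v * u)^-1)%g, (v * u)%g; split.
  - exact/nielsen_M/nielsen_P.
  - by rewrite invgM mulgA mulgV mul1g (morphV mM) mv mU_step.
  - by rewrite mM mu mv mV_step.
have up (q : int) : (exists u v, [/\ nielsen u v, markov u = mU (q - 1) &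
      markov v = mV (q - 1)]) ->
    exists u v, [/\ nielsen u v, markov u = mU q & markov v = mV q].
  case=> u [v [n mu mv]]; exists (u * v)%g, (v * (u * v)^-1)%g.
  have vE : (v * (u * v)^-1 = u^-1)%g by rewrite invgM mulVKg.
  split; first exact/nielsen_PV/nielsen_MV.
    by rewrite mM mu mv mU_step mV_step mulKg.
  by rewrite vE (morphV mM) mu mU_step invgK.
have base : exists u v, [/\ nielsen u v, markov u = mU 2 & markov v = mV 2].
  exists FX, FY; split; first exact: nielsen_id.
    by rewrite /markov evalX; exact: SL2P.
  by rewrite /markov evalY; exact: SL2P.
have -> : p = 2 + (p - 2) by lia.
case: (p - 2) => n.
  elim: n => [//|n IH]; apply: up.
  by rewrite (_ : 2 + n.+1%:Z - 1 = 2 + n%:Z); [|lia].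
elim: n => [|n IH]; first by have := down _ base.
have := down _ IH; rewrite (_ : 2 + Negz n - 1 = 2 + Negz n.+1) //; lia.
Qed.
End Terminal.

Section CommEquation.
Local Open Scope ring_scope.
Variables U V : SL2.
Hypothesis UV : comm V U = comm mB mA.

Lemma commE_mul : (V * U = comm mB mA * (U * V))%g.
Proof. by rewrite -UV /comm !freegE. Qed.

(** Here [(mB, mA)] is minus the unipotent matrix with upper right entry 6, so multiplying [U] by it
    changes the trace to [- tr U - 6 sc U]; the product is conjugate to [U]. *)
Lemma commE_U : tr U = -3 * sc U.
Proof.
have e : (V * U * V^-1 = comm mB mA * U)%g by rewrite -UV /comm !freegE.
have := trJ V U; rewrite e /tr /=; lia.
Qed.

Lemma commE_V : tr V = 3 * sc V.
Proof.
have e : (U * V^-1 * U^-1 = V^-1 * comm mB mA)%g by rewrite -UV /comm !freegE.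
have := trJ U V^-1%g; rewrite e trV /tr /=; lia.
Qed.

Lemma commE_UV : tr (U * V)%g = -3 * sc (U * V)%g.
Proof.
have := trMC V U; rewrite commE_mul [tr (comm _ _ * _)%g]/tr [tr (U * V)%g]/tr.
by move: (U * V)%g => P /=; lia.
Qed.

Lemma commE_markov : tr U ^+ 2 + tr V ^+ 2 + tr (U * V)%g ^+ 2 =
  tr U * tr V * tr (U * V)%g.
Proof.
have := tr_comm V U; rewrite UV (_ : tr (comm mB mA) = -2) // (trMC V U); lia.
Qed.

(** A zero trace forces [sc = 0], and the determinant would be minus a square. *)
Lemma commE_tr_neq0 : [/\ tr U != 0, tr V != 0 & tr (U * V)%g != 0].
Proof.
have nz (M : SL2) : sc M = 0 -> tr M != 0.
  by move=> c0; have := sdet M; rewrite /tr c0; apply: contra_eqN => /eqP; nia.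
have [hU hV hUV] : [/\ tr U = 0 -> sc U = 0, tr V = 0 -> sc V = 0 &
    tr (U * V)%g = 0 -> sc (U * V)%g = 0].
  by rewrite commE_U commE_V commE_UV; split; lia.
split; apply/eqP => t0.
- by have := nz _ (hU t0); rewrite t0.
- by have := nz _ (hV t0); rewrite t0.
- by have := nz _ (hUV t0); rewrite t0.
Qed.

Lemma commE_terminal : `|tr U|%N = 3%N -> `|tr V|%N = 3%N ->
  `|tr (U * V)%g|%N = 3%N ->
  exists p, (U = mU p \/ U = SL2N1 * mU p)%g /\ (V = mV p \/ V = SL2N1 * mV p)%g.
Proof.
move=> x3 y3 z3; have mk := commE_markov.
have xE := commE_U; have yE := commE_V; have zE := commE_UV.
have detU := sdet U; have detV := sdet V; rewrite [sc (U * V)%g]/= in zE.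
have e1 : sc U = 1 \/ sc U = -1 by lia.
have e2 : sc V = 1 \/ sc V = -1 by lia.
have z1 : tr (U * V)%g = 3 \/ tr (U * V)%g = -3 by lia.
rewrite xE yE zE in mk z1; rewrite /tr in xE yE.
(* [mU p] has first column [(p, -1)]; as [sc U] is a sign, multiplying [U] by [- sc U] brings it to
   this form. *)
exists (- sc U * sa U).
by case: e1 => cU; case: e2 => cV; rewrite cU cV in mk z1 xE yE detU detV *; split;
  (left; apply: SL2P; rewrite /= ?cU ?cV; lia) ||
  (right; apply: SL2P; rewrite /= ?cU ?cV; lia).
Qed.
End CommEquation.

(** Induction on the sum of the absolute traces. Each Vieta jump is realised by a move that keeps
    the commutator and can be undone; at the bottom, injectivity modulo sign identifies the pair
    with one from [mUV_nielsen]. *)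
Lemma comm_nielsen u v : comm v u = comm FY FX -> nielsen u v.
Proof.
have mM : {morph markov : x y / x * y} := evalM _ _.
have mV := morphV mM.
have [mX mY] : markov FX = mA /\ markov FY = mB by rewrite /markov evalX evalY.
pose size u v :=
  (`|tr (markov u)| + `|tr (markov v)| + `|tr (markov u * markov v)%g|)%N.
have [n le_n] := ubnP (size u v); elim: n u v le_n => // n IH u v le_n uv.
rewrite ltnS in le_n; have UV : comm (markov v) (markov u) = comm mB mA.
  by rewrite -mX -mY -!(morph_comm mM) uv.
have [x0 y0 z0] := commE_tr_neq0 UV.
have [lt|lt|lt|[]] := markov_descent (commE_markov UV) x0 y0 z0.
- have : nielsen u (v * u^-1).
    apply: IH; last by rewrite -uv /comm !freegE.
    apply: leq_trans le_n; rewrite /size !mM mV mulgA trJ trF.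
    rewrite (trMC (markov v)) (GRing.mulrC (tr (markov v)) (tr (markov u))).
    by rewrite addnAC ltn_add2l.
  by move/nielsen_P; rewrite mulgVK.
- have : nielsen u (v * u).
    apply: IH; last by rewrite -uv /comm !freegE.
    apply: leq_trans le_n; rewrite /size !mM (trMC (markov u) (_ * _)) trMM.
    by rewrite (trMC (markov v)) addnAC ltn_add2r ltn_add2l GRing.mulrC.
  by move/nielsen_PV; rewrite mulgK.
- have : nielsen (u * v) v.
    apply: IH; last by rewrite -uv /comm !freegE.
    apply: leq_trans le_n; rewrite /size !mM trMM.
    by lia.
  by move/nielsen_M; rewrite mulgK.
- move=> t1 t2 t3; have [p [Up Vp]] := commE_terminal UV t1 t2 t3.
  have [u' [v' [nuv mu' mv']]] := mUV_nielsen p; rewrite -mu' -mv' in Up Vp.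
  by rewrite (markov_inj Up) (markov_inj Vp).
Qed.

(** * The action of B3t on the free group *)

Section FreeAutomorphisms.

Lemma eval_cancel (a b p q : F2) :
  eval p q a = FX -> eval p q b = FY -> cancel (eval a b) (eval p q).
Proof.
move=> ea eb f; rewrite (morph_eval _ _ _ (evalM p q)) ea eb; exact: eval_id.
Qed.

Definition psiP : bij F2.
Proof.
by refine (@Bij _ (eval FX (FY * FX)) (eval FX (FY * FX^-1)) _ _);
  apply: eval_cancel; rewrite ?evalM ?evalV ?evalX ?evalY ?mulgVK ?mulgK.
Defined.

Definition psiM : bij F2.
Proof.
by refine (@Bij _ (eval (FX * FY^-1) FY) (eval (FX * FY) FY) _ _);
  apply: eval_cancel; rewrite ?evalM ?evalV ?evalX ?evalY ?mulgVK ?mulgK.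
Defined.

Definition psiE : bij F2.
Proof.
by refine (@Bij _ (eval FY FX) (eval FY FX) _ _);
  apply: eval_cancel; rewrite ?evalX ?evalY.
Defined.

Lemma psiPE : (psiP FX = FX) * (psiP FY = FY * FX).
Proof. by rewrite /= evalX evalY. Qed.
Lemma psiPVE : (psiP^-1 FX = FX) * (psiP^-1 FY = FY * FX^-1).
Proof. by rewrite /= evalX evalY. Qed.
Lemma psiME : (psiM FX = FX * FY^-1) * (psiM FY = FY).
Proof. by rewrite /= evalX evalY. Qed.
Lemma psiMVE : (psiM^-1 FX = FX * FY) * (psiM^-1 FY = FY).
Proof. by rewrite /= evalX evalY. Qed.
Lemma psiEE : (psiE FX = FY) * (psiE FY = FX).
Proof. by rewrite /= evalX evalY. Qed.

Lemma bij_eqP (g h : bij F2) : {morph g : x y / x * y} ->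
  {morph h : x y / x * y} -> g FX = h FX -> g FY = h FY -> g = h.
Proof. by move=> gM hM eX eY; apply: bijP; exact: F2_morph_eq. Qed.

Lemma psiP_morph : {morph psiP : x y / x * y}. Proof. exact: evalM. Qed.
Lemma psiM_morph : {morph psiM : x y / x * y}. Proof. exact: evalM. Qed.
Lemma psiE_morph : {morph psiE : x y / x * y}. Proof. exact: evalM. Qed.

Lemma bijM_morph (g h : bij F2) : {morph g : x y / x * y} ->
  {morph h : x y / x * y} -> {morph g * h : x y / x * y}.
Proof. by move=> gM hM x y; rewrite !bijME gM hM. Qed.

Lemma B3t_action_ex : exists2 h : B3t -> bij F2, {morph h : x y / x * y} &
  [/\ h PsiP = psiP, h PsiM = psiM & h eps = psiE].
Proof.
pose g l := match l with
  B3t_genP => psiP | B3t_genM => psiM | B3t_genE => psiE end.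
have [[PM MM] EM] := (psiP_morph, psiM_morph, psiE_morph).

have [u v|h hM hE] := @presented_lift _ B3t_rel _ g.
  case=> [p q|p q e|];
    rewrite ?lift_wordX ?lift_wordM ?lift_word1 !lift_word_letter /=.
  - apply: bij_eqP;
      repeat first [exact: PM | exact: MM | exact: EM | apply: bijM_morph];
      by rewrite !bijME; do !rewrite ?(psiPE, psiME) ?(PM, MM) ?(morphV PM)
        ?(morphV MM) ?freegE.
  - apply: bij_eqP;
      repeat first [exact: PM | exact: MM | exact: EM | apply: bijM_morph];
      rewrite // !bijME bij1E;
      by do !rewrite ?(psiPE, psiME, psiEE) ?(PM, MM, EM) ?freegE.
  - by apply: bij_eqP;
      repeat first [exact: PM | exact: MM | exact: EM | apply: bijM_morph];
      rewrite // expg2 !bijME !psiEE.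
by exists h => //; rewrite !hE !lift_word_letter.
Qed.

End FreeAutomorphisms.

Definition act : B3t -> bij F2 := s2val (cid2 B3t_action_ex).

Lemma actM : {morph act : x y / x * y}.
Proof. exact: s2valP (cid2 B3t_action_ex). Qed.

Lemma act_gen : [/\ act PsiP = psiP, act PsiM = psiM & act eps = psiE].
Proof. exact: s2valP' (cid2 B3t_action_ex). Qed.

Lemma chi_ex : exists2 h : B3t -> signs, {morph h : x y / x * y} &
  [/\ h PsiP = sign1, h PsiM = sign1 & h eps = signN1].
Proof.
pose g l := match l with B3t_genE => signN1 | _ => sign1 end.
have [u v|h hM hE] := @presented_lift _ B3t_rel _ g.
  by case=> [p q|p q e|];
    rewrite ?lift_wordX ?lift_wordM ?lift_word1 !lift_word_letter;
    exact: val_inj.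
by exists h => //; rewrite !hE !lift_word_letter.
Qed.

Definition chi : B3t -> signs := s2val (cid2 chi_ex).

Lemma chiM : {morph chi : x y / x * y}.
Proof. exact: s2valP (cid2 chi_ex). Qed.

Lemma chi_gen : [/\ chi PsiP = sign1, chi PsiM = sign1 & chi eps = signN1].
Proof. exact: s2valP' (cid2 chi_ex). Qed.

Lemma B3t_braidE : PsiP * PsiM * PsiP = PsiM * PsiP * PsiM.
Proof. by rewrite -!pres_classM; apply: pres_classR; exact: B3t_braid. Qed.

Lemma eps_eps : eps * eps = 1.
Proof. by rewrite -!pres_classM; apply: pres_classR; exact: B3t_eps2. Qed.

Lemma eps_inv : eps^-1 = eps.
Proof. exact: mulg1_eq eps_eps. Qed.

Lemma eps_PsiP : eps * PsiP * eps = PsiM^-1.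
Proof.
apply: divg1_eq; rewrite invgK -!pres_classM.
by apply: pres_classR; exact: B3t_eps.
Qed.

Lemma PsiPV : PsiP^-1 = eps * PsiM * eps.
Proof.
rewrite -[PsiM]invgK -eps_PsiP !invgM eps_inv !mulgA eps_eps mul1g.
by rewrite -mulgA eps_eps mulg1.
Qed.

(** The three generators generate [B3t] as a semigroup: conjugation by the involution [eps]
    exchanges each of [PsiP], [PsiM] with the inverse of the other. This is why a semigroup morphism
    is determined by its values on them. *)
Lemma B3t_ind (P : B3t -> Prop) :
    P PsiP -> P PsiM -> P eps -> (forall b c, P b -> P c -> P (b * c)) ->
  forall b, P b.
Proof.
move=> PP PM PE Pmul; elim/presented_ind => [|[] b|[] b].
- by rewrite -eps_eps; exact: Pmul.
- exact: Pmul.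
- exact: Pmul.
- exact: Pmul.
- by apply: (Pmul _ _ _); rewrite -/PsiP PsiPV; do 2 apply: (Pmul) => //.
- by apply: (Pmul _ _ _); rewrite -/PsiM -eps_PsiP; do 2 apply: (Pmul) => //.
- by apply: (Pmul _ _ _); rewrite -/eps eps_inv.
Qed.

Lemma act_morph b : {morph act b : x y / x * y}.
Proof.
have [aP aM aE] := act_gen; elim/B3t_ind: b => [|||b c IHb IHc].
- by rewrite aP; exact: psiP_morph.
- by rewrite aM; exact: psiM_morph.
- by rewrite aE; exact: psiE_morph.
- by rewrite actM; exact: bijM_morph.
Qed.

Lemma act_mulE b c f : act (b * c) f = act c (act b f).
Proof. by rewrite actM. Qed.

(** The product of [GTell] substitutes the second factor into the first, which is composition of
    automorphisms read from left to right. *)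
Definition quad (b : B3t) : GTquad :=
  gtq (val (chi b)) (act b FX) (act b FY).

Lemma quadM b c : quad (b * c) = quad b * quad c.
Proof.
rewrite /quad gtqM chiM !act_mulE.
by congr gtq; exact: eval_morph (act_morph c) _.
Qed.

Lemma quad_gen : [/\ quad PsiP = gtq 1%R FX (FY * FX),
  quad PsiM = gtq 1%R (FX * FY^-1) FY & quad eps = gtq (-1)%R FY FX].
Proof.
have [aP aM aE] := act_gen; have [cP cM cE] := chi_gen.
by rewrite /quad aP aM aE cP cM cE !(psiPE, psiME, psiEE).
Qed.

Lemma quad_GTell b : GTell (quad b).
Proof.
have [qP qM qE] := quad_gen; elim/B3t_ind: b => [|||b c Gb Gc].
- by rewrite qP; exact: GTell_PsiP.
- by rewrite qM; exact: GTell_PsiM.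
- by rewrite qE; exact: GTell_eps.
- by rewrite quadM; exact: GTell_mul.
Qed.

Lemma nielsen_quad u v : nielsen u v -> exists b, quad b = gtq 1%R u v.
Proof.
have [aP aM aE] := act_gen; have [cP cM cE] := chi_gen.
have [qP qM qE] := quad_gen.
have act1 : act 1 = 1 := morph1 actM.
have chi1 : chi 1 = 1 := morph1 chiM.
have sV : sign1^-1 = sign1 by exact: val_inj.
have VP : quad PsiP^-1 = gtq 1%R FX (FY * FX^-1).
  by rewrite /quad (morphV actM) (morphV chiM) aP cP sV !psiPVE.
have VM : quad PsiM^-1 = gtq 1%R (FX * FY) FY.
  by rewrite /quad (morphV actM) (morphV chiM) aM cM sV !psiMVE.
have mul g b p q r s : quad g = gtq 1%R p q -> quad b = gtq 1%R r s ->
    quad (g * b) = gtq 1%R (eval r s p) (eval r s q).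
  by move=> gE bE; rewrite quadM gE bE gtqM.
elim=> {u v} [|u v _ [b bE]|u v _ [b bE]|u v _ [b bE]|u v _ [b bE]].
- by exists 1; rewrite /quad act1 chi1 !bij1E.
- by exists (PsiP * b); rewrite (mul _ _ _ _ _ _ qP bE) evalM evalX evalY.
- by exists (PsiP^-1 * b); rewrite (mul _ _ _ _ _ _ VP bE) evalM evalV evalX evalY.
- by exists (PsiM^-1 * b); rewrite (mul _ _ _ _ _ _ VM bE) evalM evalX evalY.
- by exists (PsiM * b); rewrite (mul _ _ _ _ _ _ qM bE) evalM evalV evalX evalY.
Qed.

Lemma quad_surj x : GTell x -> exists b, quad b = x.
Proof.
move=> Gx; have [e [p [q [e1 xE]]]] := GTell_shape Gx; rewrite xE in Gx *.
have pos u v : GTell (gtq 1%R u v) -> exists b, quad b = gtq 1%R u v.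
  by move/GTell_comm/comm_nielsen/nielsen_quad.
case: e1 Gx => -> Gx; first exact: pos.
have [_ _ qE] := quad_gen.
(* Left multiplication by the image of [eps] exchanges [p] and [q] and changes the sign of
   [lambda]. *)
have [|b bE] := pos q p; last first.
  by exists (eps * b); rewrite quadM qE bE gtqM evalX evalY.
have <- : gtq (-1)%R FY FX * gtq (-1)%R p q = gtq 1%R q p.
  by rewrite gtqM evalX evalY.
by apply: GTell_mul => //; exact: GTell_eps.
Qed.

(** * Faithfulness *)

Section NormalForm.
Variables (G : groupType) (gA gD gz : G).
Hypotheses (gzA : gz = gA * gA) (gzD : gz = gD * gD * gD).

(* Alternating words in [gA] and [gD ^ (+-1)] with last letter [gD ^ (+-1)];  *)
(* the boolean tells whether the first letter is [gA].                        *)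
Inductive alt : bool -> G -> Prop :=
| alt_D : alt false gD
| alt_DV : alt false gD^-1
| alt_DM w of alt true w : alt false (gD * w)
| alt_DVM w of alt true w : alt false (gD^-1 * w)
| alt_AM w of alt false w : alt true (gA * w).

(** Normal forms for the amalgam with [A^2 = D^3]: a power of this central element times an
    alternating word, possibly followed by [gA]. *)
Inductive normal : G -> Prop :=
| normal_1 : normal 1
| normal_A : normal gA
| normal_alt s w of alt s w : normal w
| normal_altA s w of alt s w : normal (w * gA)
| normal_z x of normal x : normal (gz * x)
| normal_zV x of normal x : normal (gz^-1 * x).

Lemma gz_commute : commute gz gA /\ commute gz gD.
Proof. by split; [rewrite /commute gzA mulgA|rewrite /commute gzD !mulgA]. Qed.

(** Reduces closure under left multiplication to alternating words, where the product is again
    alternating or trivial up to a central factor. *)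
Lemma normal_mul g : commute gz g -> normal g -> normal (g * gA) ->
    (forall s w, alt s w -> exists z w', [/\ g * w = z * w',
       [\/ z = 1, z = gz | z = gz^-1] & w' = 1 \/ exists s', alt s' w']) ->
  forall x, normal x -> normal (g * x).
Proof.
move=> zg ng ngA galt; have zx z x : [\/ z = 1, z = gz | z = gz^-1] ->
    normal x -> normal (z * x).
  by case=> -> nx; [rewrite mul1g|exact: normal_z|exact: normal_zV].
move=> x; elim=> {x} [||s w aw|s w aw|x _ IH|x _ IH] //; first by rewrite mulg1.
- have [z [w' [-> zE [->|[s' aw']]]]] := galt _ _ aw; apply: zx => //.
    exact: normal_1.
  exact: normal_alt aw'.
- have [z [w' [e zE aw']]] := galt _ _ aw; rewrite mulgA e -mulgA; apply: zx => //.
  case: aw' => [->|[s' aw']]; first by rewrite mul1g; exact: normal_A.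
  exact: normal_altA aw'.
- by rewrite mulgA -zg -mulgA; exact: normal_z.
- by rewrite mulgA (commuteV (commute_sym zg)) -mulgA; exact: normal_zV.
Qed.

Lemma gD_sqr : gD * gD = gz * gD^-1.
Proof. by rewrite gzD mulgK. Qed.

Lemma gDV_sqr : gD^-1 * gD^-1 = gz^-1 * gD.
Proof. by rewrite gzD !invgM mulgA mulgVK. Qed.

Lemma normal_gA x : normal x -> normal (gA * x).
Proof.
apply: normal_mul; first by case: gz_commute.
- exact: normal_A.
- by rewrite -gzA -[gz]mulg1; apply/normal_z/normal_1.
move=> s w; case=> [||w' aw|w' aw|w' aw].
1-4: by exists 1; eexists; split; [exact/esym/mul1g|exact: Or31|
  right; exists true; do ?constructor].
exists gz, w'; split; [by rewrite mulgA -gzA|exact: Or32|].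
by right; exists false.
Qed.

Lemma normal_gD x : normal x -> normal (gD * x).
Proof.
apply: normal_mul; first by case: gz_commute.
- by apply: (normal_alt alt_D).
- by apply: (normal_altA alt_D).
move=> s w; case=> [||w' aw|w' aw|w' aw].
- exists gz, gD^-1; split; [exact: gD_sqr|exact: Or32|].
  by right; exists false; constructor.
- by exists 1, 1; split; [rewrite mulgV mulg1|exact: Or31|left].
- exists gz, (gD^-1 * w'); split; [by rewrite !mulgA gD_sqr|exact: Or32|].
  by right; exists false; constructor.
- by exists 1, w'; split; [rewrite mulVKg mul1g|exact: Or31|right; exists true].
- exists 1, (gD * (gA * w')); split; [by rewrite mul1g|exact: Or31|].
  by right; exists false; do 2 constructor.
Qed.

Lemma normal_gDV x : normal x -> normal (gD^-1 * x).
Proof.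
apply: normal_mul; first by case: gz_commute => _ /commuteV.
- by apply: (normal_alt alt_DV).
- by apply: (normal_altA alt_DV).
move=> s w; case=> [||w' aw|w' aw|w' aw].
- by exists 1, 1; split; [rewrite mulVg mulg1|exact: Or31|left].
- exists gz^-1, gD; split; [exact: gDV_sqr|exact: Or33|].
  by right; exists false; constructor.
- by exists 1, w'; split; [rewrite mulKg mul1g|exact: Or31|right; exists true].
- exists gz^-1, (gD * w'); split; [by rewrite !mulgA gDV_sqr|exact: Or33|].
  by right; exists false; constructor.
- exists 1, (gD^-1 * (gA * w')); split; [by rewrite mul1g|exact: Or31|].
  by right; exists false; do 2 constructor.
Qed.

Lemma normal_gAV x : normal x -> normal (gA^-1 * x).
Proof.
move=> nx; rewrite -[gA^-1](mulgVK gA) -invgM -gzA -mulgA.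
exact/normal_zV/normal_gA.
Qed.

End NormalForm.

(** The half twist of the braid group on three strands; [bz] is the full twist. *)
Definition bA := PsiP * PsiM * PsiP.
Definition bD := PsiP * PsiM.
Definition bz := bA * bA.

Lemma bzD : bz = bD * bD * bD.
Proof. by rewrite /bz /bA {2}B3t_braidE /bD !mulgA. Qed.

Lemma PsiP_normal : PsiP = bD^-1 * bA.
Proof. by rewrite /bA -/bD mulKg. Qed.

Lemma PsiM_normal : PsiM = bA^-1 * bD * bD.
Proof. by rewrite /bA -/bD invgM mulgVK /bD mulKg. Qed.

Lemma PsiMV_normal : PsiM^-1 = bD^-1 * bD^-1 * bA.
Proof.
have E (G : groupType) (a b : G) : (a^-1 * b * b)^-1 = b^-1 * b^-1 * a.
  by rewrite !invgM invgK mulgA.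
by rewrite PsiM_normal E.
Qed.

Notation bnormal := (normal bA bD bz).

Definition signed_normal b := exists x, bnormal x /\
  (chi b = sign1 /\ b = x \/ chi b = signN1 /\ b = eps * x).

(** Moving [eps] to the left past a generator replaces it by the inverse of the other; [chi] records
    the parity of the collected [eps]. *)
Lemma B3t_normal b : signed_normal b.
Proof.
have nA := @normal_gA _ bA bD bz erefl bzD.
have nD := @normal_gD _ bA bD bz erefl bzD.
have nAV := @normal_gAV _ bA bD bz erefl bzD.
have nDV := @normal_gDV _ bA bD bz erefl bzD.
have nP x : bnormal x -> bnormal (PsiP * x).
  by move=> nx; rewrite PsiP_normal -mulgA; apply/nDV/nA.
have nM x : bnormal x -> bnormal (PsiM * x).
  by move=> nx; rewrite PsiM_normal -2!mulgA; apply/nAV/nD/nD.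
have nPV x : bnormal x -> bnormal (PsiP^-1 * x).
  by move=> nx; rewrite PsiP_normal invgM invgK -mulgA; apply/nAV/nD.
have nMV x : bnormal x -> bnormal (PsiM^-1 * x).
  move=> nx; rewrite PsiMV_normal -2!mulgA.
  by apply/nDV/nDV/nA.
have [cP cM cE] := chi_gen.
have [s11 sN1] : sign1 * sign1 = sign1 /\ sign1 * signN1 = signN1.
  by split; exact: val_inj.
have [sNN sN1'] : signN1 * signN1 = sign1 /\ signN1 * sign1 = signN1.
  by split; exact: val_inj.
have push g h b1 : chi g = sign1 -> g * eps = eps * h ->
    (forall x, bnormal x -> bnormal (g * x)) ->
    (forall x, bnormal x -> bnormal (h * x)) ->
    signed_normal b1 -> signed_normal (g * b1).
  move=> cg gh ng nh [x [nx [[c1 b1E]|[c1 b1E]]]].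
    exists (g * x); split; first exact: ng.
    by left; rewrite chiM cg c1 s11 b1E.
  exists (h * x); split; first exact: nh.
  by right; rewrite chiM cg c1 sN1 b1E mulgA gh mulgA.
have PE : PsiP * eps = eps * PsiM^-1.
  by rewrite -eps_PsiP !mulgA eps_eps mul1g.
have ME : PsiM * eps = eps * PsiP^-1.
  by rewrite PsiPV !mulgA eps_eps mul1g.
have PVE : PsiP^-1 * eps = eps * PsiM by rewrite PsiPV -mulgA eps_eps mulg1.
have MVE : PsiM^-1 * eps = eps * PsiP by rewrite -eps_PsiP -mulgA eps_eps mulg1.
have epsM b1 : signed_normal b1 -> signed_normal (eps * b1).
  case=> x [nx [[c1 b1E]|[c1 b1E]]]; exists x; split=> //.
    by right; rewrite chiM cE c1 b1E sN1'.
  by left; rewrite chiM cE c1 b1E sNN mulgA eps_eps mul1g.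
elim/presented_ind: b => [|[] b|[] b].
- exists 1; split; first exact: normal_1.
  by left; split=> //; exact: morph1 chiM.
- exact: (push _ _ _ cP PE nP nMV).
- exact: (push _ _ _ cM ME nM nPV).
- exact: epsM.
- by apply: (push _ _ _ _ PVE nPV nM); rewrite (morphV chiM) cP.
- by apply: (push _ _ _ _ MVE nMV nP); rewrite (morphV chiM) cM.
- by rewrite -/eps eps_inv; exact: epsM.
Qed.

(** The additive group of integers, a target for [eval] on [F2]. *)
Definition zint := int.
HB.instance Definition _ := Choice.on zint.
HB.instance Definition _ := isGroup.Build zint
  (@GRing.addrA int) (@GRing.add0r int) (@GRing.addr0 int)
  (@GRing.addNr int) (@GRing.addrN int).

(* [B3t] acts from the left on [Hom(F_2, Z) = Z^2]. *)
Definition vact (b : B3t) (v : int * int) : int * int :=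
  let h := eval (v.1 : zint) (v.2 : zint) in (h (act b FX), h (act b FY)).

Lemma vactM b c v : vact (b * c) v = vact b (vact c v).
Proof.
rewrite /vact !act_mulE; set h := eval _ _.
have hM : {morph h : x y / x * y} := evalM _ _.
by congr pair; rewrite (eval_morph (act_morph c)) (morph_eval _ _ _ hM).
Qed.

Section VectorAction.
Local Open Scope ring_scope.

Lemma vact_id b v : act b = 1%g -> vact b v = v.
Proof. by case: v => p q e; rewrite /vact e !bij1E evalX evalY. Qed.

Lemma vactP p q : vact PsiP (p, q) = (p, q + p).
Proof.
by have [aP _ _] := act_gen; rewrite /vact aP !psiPE evalM evalX evalY.
Qed.

Lemma vactM' p q : vact PsiM (p, q) = (p - q, q).
Proof.
by have [_ aM _] := act_gen; rewrite /vact aM !psiME evalM evalV evalX evalY.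
Qed.

Lemma vact_V b v w : vact b v = w -> vact b^-1%g w = v.
Proof. by move=> <-; rewrite -vactM mulVg vact_id // (morph1 actM). Qed.

Lemma vact_bD p q : vact bD (p, q) = (p - q, p).
Proof. by rewrite vactM vactM' vactP; congr pair; lia. Qed.

Lemma vact_bDV p q : vact bD^-1%g (p, q) = (q, q - p).
Proof. by apply: vact_V; rewrite vact_bD; congr pair; lia. Qed.

Lemma vact_bA p q : vact bA (p, q) = (- q, p).
Proof. by rewrite !vactM vactP vactM' vactP; congr pair; lia. Qed.

Lemma vact_bz p q : vact bz (p, q) = (- p, - q).
Proof. by rewrite vactM !vact_bA. Qed.

Lemma vact_bzV p q : vact bz^-1%g (p, q) = (- p, - q).
Proof. by apply: vact_V; rewrite vact_bz; congr pair; lia. Qed.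

Definition sector (s : bool) (v : int * int) : Prop :=
  if s then (0 < v.1 /\ v.2 < 0 \/ v.1 < 0 /\ 0 < v.2)
  else (0 < v.1 /\ 0 < v.2 \/ v.1 < 0 /\ v.2 < 0).

(** Ping-pong on the signs of the coordinates: [bD] and its inverse lead from opposite to equal
    signs, [bA] back. The second clause keeps the image off the diagonal or antidiagonal, where the
    test vectors of [normal_fix] lie. *)
Lemma alt_sector s w v : alt bA bD s w -> sector true v ->
  sector s (vact w v) /\
  (vact w v).2 <> (if s then - (vact w v).1 else (vact w v).1).
Proof.
move=> aw sv; elim: aw => {s w} [||w _|w _|w _].
1,2: by case: v sv => p q; rewrite ?vact_bD ?vact_bDV /=; split; lia.
all: by rewrite vactM; case: (vact w v) => p q;
  rewrite ?vact_bD ?vact_bDV ?vact_bA => -[] /=; split; lia.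
Qed.
End VectorAction.

Definition bz_power x := exists n, x = bz ^+ n \/ x = bz ^- n.

Lemma bz_powerM x : bz_power x -> bz_power (bz * x).
Proof.
case=> [n [->|->]]; first by exists n.+1; left; rewrite expgS.
case: n => [|n]; first by exists 1%N; left; rewrite expg0 invg1 mulg1 expg1.
by exists n; right; rewrite expgSr (invgM (bz ^+ n)) mulVKg.
Qed.

Lemma bz_powerVM x : bz_power x -> bz_power (bz^-1 * x).
Proof.
case=> [n [->|->]]; last by exists n.+1; right; rewrite expgSr (invgM (bz ^+ n)).
case: n => [|n]; first by exists 1%N; right; rewrite expg0 mulg1 expg1.
by exists n; left; rewrite expgS mulKg.
Qed.

Lemma bz_power_vact x : bz_power x ->
  (forall p q, vact x (p, q) = (p, q)) \/
  (forall p q, vact x (p, q) = (- p, - q)%R).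
Proof.
have pow c n : (forall p q, vact c (p, q) = (- p, - q)%R) ->
  (forall p q, vact (c ^+ n) (p, q) = (p, q)) \/
  (forall p q, vact (c ^+ n) (p, q) = (- p, - q)%R).
  move=> cN; elim: n => [|n [] IH].
  - by left=> p q; rewrite vact_id // (morph1 actM).
  - by right=> p q; rewrite expgS vactM IH cN.
  - by left=> p q; rewrite expgS vactM IH cN; congr pair; lia.
case=> n [] ->; first exact: pow vact_bz.
by rewrite -expVgn; exact: pow vact_bzV.
Qed.

Lemma normal_shape x : normal bA bD bz x -> exists z y,
  [/\ x = z * y, bz_power z & [\/ y = 1, y = bA, exists s, alt bA bD s y |
     exists s w, alt bA bD s w /\ y = w * bA]].
Proof.
have p1 : bz_power 1 by exists 0%N; left.
elim=> {x} [||s w aw|s w aw|x _ [z [y [-> pz ny]]]|x _ [z [y [-> pz ny]]]].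
- by exists 1, 1; split; [rewrite mul1g|exact: p1|exact: Or41].
- by exists 1, bA; split; [rewrite mul1g|exact: p1|exact: Or42].
- by exists 1, w; split; [rewrite mul1g|exact: p1|apply: Or43; exists s].
- by exists 1, (w * bA); split; [rewrite mul1g|exact: p1|apply: Or44; exists s, w].
- by exists (bz * z), y; split; [exact: mulgA|exact: bz_powerM|].
- by exists (bz^-1 * z), y; split; [exact: mulgA|exact: bz_powerVM|].
Qed.

(** [bz] acts as -1, so the alternating part [y] acts as 1 or -1. The vectors [(1, -1)] and [(1, 1)]
    refute this unless [y] is trivial. *)
Lemma normal_fix x : normal bA bD bz x -> (forall v, vact x v = v) -> bz_power x.
Proof.
case/normal_shape => z [y [-> pz yE]] fx.
have yfx v : vact y v = v \/ vact y v = (- v.1, - v.2)%R.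
  have := fx v; rewrite vactM; case: (vact y v) => p q; case: v => p' q'.
  by case: (bz_power_vact pz) => -> [<- <-]; [left|right; rewrite /= !GRing.opprK].
case: yE => [->|yE|[s aw]|[s [w [aw yE]]]]; first by rewrite mulg1.
- by have := yfx (1, 1)%R; rewrite yE vact_bA; case=> [[]|[]].
- exfalso; have [] := alt_sector aw (v := (1, -1)%R); first by left.
  by case: (yfx (1, -1)%R) => ->; case: (s); rewrite /=; lia.
- exfalso; have [] := alt_sector aw (v := (-1, 1)%R); first by right.
  have -> : vact w (-1, 1)%R = vact y (1, 1)%R by rewrite yE vactM vact_bA.
  by case: (yfx (1, 1)%R) => ->; case: (s); rewrite /=; lia.
Qed.

(** * The full twist has infinite order on [F2] *)

Lemma act_bA : (act bA FX = FY^-1) * (act bA FY = FY * FX * FY^-1).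
Proof.
have [aP aM _] := act_gen; have [PM MM] := (psiP_morph, psiM_morph).
rewrite !act_mulE aP aM !(psiPE, PM).
by do !rewrite ?(psiPE, psiME) ?(PM, MM) ?(morphV PM) ?(morphV MM) ?freegE.
Qed.

Lemma act_bz :
  (act bz FX = FY * FX^-1 * FY^-1) * (act bz FY = FY * FX * FY^-1 * FX^-1 * FY^-1).
Proof.
have aM := act_morph bA; have aV := morphV aM.
rewrite /bz !(act_mulE bA bA) !act_bA !(aV, aM) !act_bA.
by rewrite !freegE.
Qed.

Lemma act_bz2 f : act (bz * bz) f = comm FY FX * f * (comm FY FX)^-1.
Proof.
have aM := act_morph bz; have aV := morphV aM.
move: f; apply: (@F2_morph_eq _ (act (bz * bz)) (fun f => comm FY FX * f * _^-1));
  [exact: act_morph|exact: conj_morph| |].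
  by rewrite (act_mulE bz bz) !act_bz !(aV, aM) !act_bz /comm !freegE.
by rewrite (act_mulE bz bz) !act_bz !(aV, aM) !act_bz /comm !freegE.
Qed.

Lemma comm_markov_power n : exists2 e : int, (e = 1 \/ e = -1)%R &
  [/\ sa (comm mB mA ^+ n) = e, sb (comm mB mA ^+ n) = (e * (6 * n%:Z))%R,
      sc (comm mB mA ^+ n) = 0%R & sd (comm mB mA ^+ n) = e].
Proof.
elim: n => [|n [e e1 [ea eb ec ed]]]; first by exists 1%R; [left|].
exists (- e)%R; first by lia.
have -> : comm mB mA ^+ n.+1 = SL2mul (comm mB mA) (comm mB mA ^+ n).
  exact: expgS.
by rewrite /= ea eb ec ed; split; lia.
Qed.

(** The square of [bz^n] acts as conjugation by [c^n], so [c^n] commutes with [X]. Its matrix is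
    unipotent up to sign with upper right entry [6 n]; comparing upper left entries with [mA] gives
    [n = 0]. *)
Lemma act_bz_power n : act (bz ^+ n) = 1 -> n = 0%N.
Proof.
move=> e; have [c cE] : exists c, c = comm FY FX by exists (comm FY FX).
have mM : {morph markov : x y / x * y} := evalM _ _.
have conj k f : act ((bz * bz) ^+ k) f = c ^+ k * f * (c ^+ k)^-1.
  elim: k f => [|k IH] f; first by rewrite (morph1 actM) bij1E invg1 mulg1 mul1g.
  rewrite (expgSr (bz * bz)) act_mulE act_bz2 -cE IH (expgS c).
  by rewrite invgM !mulgA.
have : act ((bz * bz) ^+ n) FX = FX.
  by rewrite expgMn ?act_mulE ?e // /commute.
rewrite conj => /(congr1 (fun g => markov (g * c ^+ n))).
rewrite mulgVK !mM !(morphX mM) cE !(morph_comm mM) => /(congr1 sa).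
rewrite /markov evalX evalY.
have [s s1 [ea eb ec ed]] := comm_markov_power n.
by rewrite /= ea eb ec; lia.
Qed.

Lemma act_kernel b : act b = 1 -> chi b = sign1 -> b = 1.
Proof.
move=> b1 cb; have [x [nx [[_ bx]|[cb' _]]]] := B3t_normal b; last first.
  by have := congr1 val (etrans (esym cb) cb').
have [|n xE] := normal_fix nx; first by move=> v; rewrite -bx vact_id.
rewrite bx; case: xE => xE.
  by rewrite xE (act_bz_power (n := n)) // -xE -bx.
rewrite xE (act_bz_power (n := n)) ?invg1 //.
by apply: invg_inj; rewrite -(morphV actM) -xE -bx b1 invg1.
Qed.

Lemma quad_inj : injective quad.
Proof.
move=> b c e; have eX : act b FX = act c FX := congr1 GTgp e.
have eY : act b FY = act c FY := congr1 GTgm e.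
have ec : chi b = chi c.
  by apply: val_inj; exact: (congr1 (fun x => GTlam (GTpart x)) e).
have eb : act b = act c by apply: bij_eqP eX eY; exact: act_morph.
apply: divg1_eq; apply: act_kernel.
  by rewrite actM (morphV actM) eb mulgV.
by rewrite chiM (morphV chiM) ec mulgV.
Qed.

(** * The commutative square and its two isomorphisms *)

Definition B3t_GTell (b : B3t) : GTell :=
  exist _ (quad b) (mem_set (quad_GTell b)).

Lemma sign_eq (s : signs) : s = sign1 \/ s = signN1.
Proof.
by case: s => k k1; case/orP: (k1) => /eqP ke; [left|right]; exact: val_inj.
Qed.

Lemma sign_GTP (s : signs) : MkGTpair (val s) 1 \in GT.
Proof.
by apply/mem_set/sign_GT; case: (sign_eq s) => ->; [left|right].
Qed.

Definition sign_GTpair (s : signs) : GT :=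
  exist _ (MkGTpair (val s) 1) (sign_GTP s).

Lemma B3t_GTell_bij : bijective B3t_GTell.
Proof.
have surj (x : GTell) : exists b, quad b = val x.
  by apply: quad_surj; exact: set_mem (valP x).
exists (fun x => sval (cid (surj x))) => [b|x].
  by apply: quad_inj; case: cid.
by apply: val_inj; case: cid.
Qed.

Lemma sign_GTpair_bij : bijective sign_GTpair.
Proof.
have surj (x : GT) : exists s, sign_GTpair s = x.
  case: x => -[lam f] Gx; have [/= f1 lam1] := GT_sign (set_mem Gx); subst f.
  have sl : is_sign lam by case: lam1 => ->.
  by exists (exist _ lam sl); apply: val_inj.
exists (fun x => sval (cid (surj x))) => [s|x]; last by case: cid.
by case: cid => s' /= /(congr1 (fun x : GT => GTlam (val x))) /= e; exact: val_inj.
Qed.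

Theorem proposition2p5 :
  exists (phi : B3t -> GTell) (chi : B3t -> signs) (iota : signs -> GT),
  [/\ unique (fun phi : B3t -> GTell =>
        [/\ is_semigroup_morphism phi,
            val (phi PsiP) = MkGTquad (MkGTpair 1%R 1) FX (FY * FX),
            val (phi PsiM) = MkGTquad (MkGTpair 1%R 1) (FX * FY^-1) FY &
            val (phi eps) = MkGTquad (MkGTpair (-1)%R 1) FY FX]) phi,
      unique (fun chi : B3t -> signs =>
        [/\ {morph chi : x y / x * y},
            chi PsiP = sign1, chi PsiM = sign1 & chi eps = signN1]) chi,
      unique (fun iota : signs -> GT =>
        is_semigroup_morphism iota /\
        val (iota signN1) = MkGTpair (-1)%R 1) iota,
      forall b : B3t, GTproj (phi b) = iota (chi b) &
      bijective phi /\ bijective iota].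
Proof.
have [qP qM qE] := quad_gen; have [cP cM cE] := chi_gen.
exists B3t_GTell, chi, sign_GTpair; split.
- split; first by split=> //; move=> b c; exact: quadM.
  move=> psi [psiMul psiP psiM psiE]; apply/funext; elim/B3t_ind => [|||b c eb ec].
  1-3: by apply: val_inj; rewrite ?psiP ?psiM ?psiE.
  by apply: val_inj; rewrite psiMul -eb -ec; exact: quadM.
- split; first by split=> //; exact: chiM.
  move=> psi [psiMul psiP psiM psiE]; apply/funext; elim/B3t_ind => [|||b c eb ec].
  1-3: by rewrite ?cP ?cM ?cE.
  by rewrite chiM psiMul eb ec.
- split; first split=> //.
    by move=> s t; rewrite /= GTpairM.
  move=> psi [psiMul psiN]; apply/funext => s; apply: val_inj.
  case: (sign_eq s) => ->; last by rewrite psiN.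
  (* A semigroup morphism need not preserve 1 by definition; here its value at 1 is forced because 1
     is the square of -1. *)
  have -> : sign1 = signN1 * signN1 by exact: val_inj.
  by rewrite psiMul psiN GTpairM.
- by move=> b; apply: val_inj.
- by split; [exact: B3t_GTell_bij|exact: sign_GTpair_bij].
Qed.
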